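(* If $C_1\colon y^2=f_1(x)$ and $C_2\colon y^2=f_2(x)$ are hyperelliptic curves over $K$ that are isomorphic over $K$, then their cluster pictures are equivalent.
   Context: $K$ is a non-archimedean local field with finite residue field of odd characteristic and valuation $v$ on $\bar K$ normalised on $K$. A hyperelliptic curve $y^2=f(x)$ has $f\in K[x]$ separable of degree $2g+1$ or $2g+2$, $g\ge2$; its cluster picture $(\Sigma,\mathcal R,d)$ has $\mathcal R$ the set of roots of $f$, $\Sigma$ the set of non-empty subsets $D\cap\mathcal R$ for discs $D=\{x\in\bar K:v(x-z)\ge d\}$, and depth $d_{\mathfrak s}=\min_{r,r'\in\mathfrak s}v(r-r')$ for $|\mathfrak s|>1$. Abstractly, a cluster picture $(\Sigma,\mathcal R,d)$ is a finite set $\mathcal R$ with a collection $\Sigma$ of non-empty subsets containing all singletons and $\mathcal R$, pairwise disjoint or nested, and depths $d_{\mathfrak s}\in\mathbb Q$ for $|\mathfrak s|>1$ with $d_{\mathfrak t}>d_{\mathfrak s}$ for $\mathfrak t\subsetneq\mathfrak s$; children, parent $P$ and relative depth $\delta_{\mathfrak s}=d_{\mathfrak s}-d_{P(\mathfrak s)}$ as usual. Isomorphism: bijection of the underlying sets inducing a bijection of clusters and preserving depths. Two cluster pictures are equivalent if one is isomorphic to a picture obtained from the other by finitely many of the following steps: (a) increase the depth of all proper clusters by some $m\in\mathbb Q$; (b) if $|\mathcal R|$ is odd, add a root: $\mathcal R'=\mathcal R\cup\{r\}$, $\Sigma'=\Sigma\cup\{\{r\},\mathcal R'\}\setminus\{\mathcal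 R\}$, other depths unchanged, $d'_{\mathcal R'}=d_{\mathcal R}$; (c) if $|\mathcal R|$ is even, $\{r\}$ is a child of $\mathcal R$ and $\mathcal R\setminus\{r\}\notin\Sigma$, remove $r$: $\mathcal R'=\mathcal R\setminus\{r\}$, $\Sigma'=\Sigma\cup\{\mathcal R'\}\setminus\{\mathcal R,\{r\}\}$, other depths unchanged, $d'_{\mathcal R'}=d_{\mathcal R}$; (d) if $|\mathcal R|$ is even, $\mathfrak s$ is a child of $\mathcal R$, $\mathfrak s^c=\mathcal R\setminus\mathfrak s$, and $-\delta_{\mathfrak s}\le m\le\delta_{\mathfrak s^c}$ (with $\delta_{\mathfrak s^c}=0$ if $\mathfrak s^c\notin\Sigma$, and depth $+\infty$ for singletons), redistribute: $\Sigma'=\Sigma\cup\{\mathfrak s,\mathfrak s^c\}$, $d'_{\mathcal R}=d_{\mathcal R}$, $d'_{\mathfrak t}=d_{\mathfrak t}+m$ for proper $\mathfrak t\subseteq\mathfrak s$ and $d'_{\mathfrak t}=d_{\mathfrak t}-m$ for proper $\mathfrak t\subseteq\mathfrak s^c$ (taking $d_{\mathfrak s^c}=d_{\mathcal R}$ if $\mathfrak s^c$ was not a cluster); finally remove $\mathfrak s$ (resp. $\mathfrak s^c$) from $\Sigma'$ if its new relative depth is $0$. *)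

(* Defs.v *)
From HB Require Import structures.
From mathcomp Require Import all_boot all_order all_algebra.
From mathcomp Require Import separable.
From Stdlib Require Import Relations.Relation_Operators.
Set Implicit Arguments.
Unset Strict Implicit.
Unset Printing Implicit Defensive.
Import Order.TTheory GRing.Theory Num.Theory.
Local Open Scope ring_scope.

(* K is the local field, L plays the role of an algebraic closure of K *)
(* (via j : K -> L), v : L -> rat is the valuation on L (its value at 0 *)
(* is irrelevant and unconstrained; "v 0 = +oo" is handled explicitly). *)

Definition is_valuation (L : fieldType) (v : L -> rat) : Prop :=
  (forall a b, a != 0 -> b != 0 -> v (a * b) = v a + v b) /\
  (forall a b, a != 0 -> b != 0 -> a + b != 0 ->
     v a <= v (a + b) \/ v b <= v (a + b)).

Definition algebraic_over (K L : fieldType) (j : {rmorphism K -> L}) : Prop :=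
  forall z : L, exists p : {poly K}, p != 0 /\ root (map_poly j p) z.

Definition normalised_on (K L : fieldType) (j : {rmorphism K -> L}) (v : L -> rat) :=
  (forall k : K, k != 0 -> exists z : int, v (j k) = z%:~R) /\
  (exists k : K, k != 0 /\ v (j k) = 1).

(* a and b are v-close at level N : v(a - b) >= N (with v(0) = +oo) *)
Definition vclose (K L : fieldType) (j : {rmorphism K -> L}) (v : L -> rat)
  (N : rat) (a b : K) : Prop := a = b \/ N <= v (j (a - b)).

Definition complete_for (K L : fieldType) (j : {rmorphism K -> L}) (v : L -> rat) :=
  forall u : nat -> K,
    (forall N : rat, exists M : nat, forall m n, (M <= m)%N -> (M <= n)%N ->
        vclose j v N (u m) (u n)) ->
    exists l : K, forall N : rat, exists M : nat, forall n, (M <= n)%N ->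
        vclose j v N (u n) l.

Definition in_int_ring (K L : fieldType) (j : {rmorphism K -> L}) (v : L -> rat) (k : K) :=
  k = 0 \/ 0 <= v (j k).

Definition finite_residue_field (K L : fieldType) (j : {rmorphism K -> L}) (v : L -> rat) :=
  exists s : seq K, (forall k0, k0 \in s -> in_int_ring j v k0) /\
    forall k, in_int_ring j v k ->
      exists2 k0, k0 \in s & (k = k0 \/ 0 < v (j (k - k0))).

Definition odd_residue_char (K L : fieldType) (j : {rmorphism K -> L}) (v : L -> rat) :=
  (2%:R : K) != 0 /\ v (j 2%:R) = 0.

Definition local_field_setup (K : fieldType) (L : closedFieldType)
  (j : {rmorphism K -> L}) (v : L -> rat) : Prop :=
  [/\ is_valuation v, algebraic_over j, normalised_on j v,
      complete_for j v & finite_residue_field j v /\ odd_residue_char j v].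

Definition hyperelliptic_poly (K : fieldType) (f : {poly K}) : Prop :=
  separable_poly f /\
  exists g : nat, (2 <= g)%N /\ (size f = (2 * g + 2)%N \/ size f = (2 * g + 3)%N).

(* F (a field extension of K via iota) is the function field of y^2 = f(x),
   with generic point (x, y): x transcendental over K, y^2 = f(x),
   and F generated as a field over K by x and y. *)
Definition is_function_field (K F : fieldType) (iota : {rmorphism K -> F})
  (f : {poly K}) (x y : F) : Prop :=
  [/\ (forall p : {poly K}, p != 0 -> (map_poly iota p).[x] != 0),
      y ^+ 2 = (map_poly iota f).[x] &
      (forall S : {pred F},
         (forall k, iota k \in S) -> x \in S -> y \in S ->
         (forall a b, a \in S -> b \in S -> a - b \in S) ->
         (forall a b, a \in S -> b \in S -> a * b \in S) ->
         (forall a, a \in S -> a^-1 \in S) ->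
         forall z, z \in S)].

Definition curves_iso_over (K : fieldType) (f1 f2 : {poly K}) : Prop :=
  exists (F1 F2 : fieldType) (i1 : {rmorphism K -> F1}) (i2 : {rmorphism K -> F2})
         (x1 y1 : F1) (x2 y2 : F2) (phi : {rmorphism F1 -> F2}),
    [/\ is_function_field i1 f1 x1 y1, is_function_field i2 f2 x2 y2,
        bijective phi & forall k, phi (i1 k) = i2 k].

(* underlying finite set R = cp_T, clusters Sigma = cp_S, depths cp_d
   (only meaningful on clusters of size > 1) *)
Record cpic := CPic {
  cp_T : finType;
  cp_S : {set {set cp_T}};
  cp_d : {set cp_T} -> rat }.
Arguments cp_S : clear implicits.
Arguments cp_d : clear implicits.

Definition cp_valid (A : cpic) : Prop :=
  [/\ (forall x : cp_T A, [set x] \in cp_S A),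
      [set: cp_T A] \in cp_S A,
      (forall s, s \in cp_S A -> s != set0),
      (forall s t, s \in cp_S A -> t \in cp_S A ->
         [|| [disjoint s & t], s \subset t | t \subset s]) &
      (forall s t, s \in cp_S A -> t \in cp_S A -> (1 < #|s|)%N -> (1 < #|t|)%N ->
         t \proper s -> cp_d A s < cp_d A t)].

(* step (a) composed with an isomorphism; m = 0 gives isomorphism *)
Definition cp_shift_iso (m : rat) (A B : cpic) : Prop :=
  exists h : cp_T A -> cp_T B,
    [/\ bijective h,
        (forall s : {set cp_T A}, (s \in cp_S A) = (h @: s \in cp_S B)) &
        (forall s, s \in cp_S A -> (1 < #|s|)%N -> cp_d B (h @: s) = cp_d A s + m)].

Definition cp_iso (A B : cpic) : Prop := cp_shift_iso 0 A B.

Definition cp_add_root (A B : cpic) : Prop :=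
  odd #|cp_T A| /\
  exists (i : cp_T A -> cp_T B) (r : cp_T B),
    [/\ injective i, (forall x, x != r -> exists a, i a = x), (forall a, i a != r),
        (forall t : {set cp_T B}, (t \in cp_S B) =
           [|| t == [set r], t == setT |
               [&& r \notin t, i @^-1: t \in cp_S A & i @^-1: t != setT]]) &
        cp_d B setT = cp_d A setT /\
        (forall s, s \in cp_S A -> s != setT -> (1 < #|s|)%N ->
           cp_d B (i @: s) = cp_d A s)].

Definition cp_remove_root (A B : cpic) : Prop :=
  ~~ odd #|cp_T A| /\
  exists (i : cp_T B -> cp_T A) (r : cp_T A),
    [/\ injective i /\ (forall x, x != r -> exists b, i b = x) /\ (forall b, i b != r),
        [set r] \in cp_S A /\
          (forall t, t \in cp_S A -> [set r] \proper t -> t \proper setT -> False),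
        (~: [set r]) \notin cp_S A &
        (forall t : {set cp_T B}, (t \in cp_S B) = (t == setT) || (i @: t \in cp_S A)) /\
        cp_d B setT = cp_d A setT /\
        (forall t, t \in cp_S B -> t != setT -> (1 < #|t|)%N ->
           cp_d B t = cp_d A (i @: t))].

Definition cp_redistribute (m : rat) (A B : cpic) : Prop :=
  ~~ odd #|cp_T A| /\
  exists s : {set cp_T A},
    let dR := cp_d A setT in
    let sc := ~: s in
    let dsc := if sc \in cp_S A then cp_d A sc else dR in
    let keep_s := (#|s| == 1%N) || (cp_d A s + m != dR) in
    let keep_sc := (#|sc| == 1%N) || (dsc - m != dR) in
    [/\
        s \in cp_S A /\ s != setT /\
          (forall t, t \in cp_S A -> s \proper t -> t \proper setT -> False),
        (* - delta_s <= m  (no constraint if s is a singleton) *)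
        ((1 < #|s|)%N -> dR - cp_d A s <= m),
        (* m <= delta_{s^c} (0 if s^c not a cluster, +oo if a singleton) *)
        (if sc \in cp_S A then ((1 < #|sc|)%N -> m <= cp_d A sc - dR) else m <= 0) &
        exists h : cp_T A -> cp_T B,
          [/\ bijective h,
              (forall t : {set cp_T A}, (h @: t \in cp_S B) =
                 if t == s then keep_s else if t == sc then keep_sc else t \in cp_S A),
              cp_d B (h @: setT) = dR,
              (forall t : {set cp_T A}, t \subset s -> (1 < #|t|)%N -> t \in cp_S A ->
                 h @: t \in cp_S B -> cp_d B (h @: t) = cp_d A t + m) &
              (forall t : {set cp_T A}, t \subset sc -> (1 < #|t|)%N -> h @: t \in cp_S B ->
                 cp_d B (h @: t) = (if t \in cp_S A then cp_d A t else dR) - m)]].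

Definition cp_step (A B : cpic) : Prop :=
  [/\ cp_valid A, cp_valid B &
      [\/ exists m, cp_shift_iso m A B, cp_add_root A B, cp_remove_root A B
        | exists m, cp_redistribute m A B]].

Definition cp_equiv (A B : cpic) : Prop :=
  (exists C, clos_refl_trans cpic cp_step A C /\ cp_iso C B) \/
  (exists C, clos_refl_trans cpic cp_step B C /\ cp_iso C A).

(* The cluster picture of f (relative to j, v): A is (up to the         *)
(* bijection rho) the set of roots of f in L with clusters D /\ R for   *)
(* discs D = {x : v(x - z) >= d} and depths min_{r <> r'} v(r - r').    *)
Definition cluster_picture_of (K : fieldType) (L : closedFieldType)
  (j : {rmorphism K -> L}) (v : L -> rat) (f : {poly K}) (A : cpic) : Prop :=
  exists rho : cp_T A -> L,
    [/\ injective rho,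
        (forall z : L, root (map_poly j f) z <-> exists a, rho a = z),
        (forall s : {set cp_T A}, s \in cp_S A <->
           (s != set0 /\ exists (z : L) (d : rat),
              forall a, (a \in s) = (rho a == z) || (d <= v (rho a - z)))) &
        (forall s, s \in cp_S A -> (1 < #|s|)%N ->
           (forall a b, a \in s -> b \in s -> a != b -> cp_d A s <= v (rho a - rho b)) /\
           exists a b, [/\ a \in s, b \in s, a != b & cp_d A s = v (rho a - rho b)])].

(* Main.v *)
(* An isomorphism over K of the two curves identifies their function fields, hence gives a
   field F with generators (x1, y1) and (x2, y2). Since [F : K(x1)] = [F : K(x2)] = 2,
   Gauss's lemma produces a relation p(x1) x2^2 + q(x1) x2 + r(x1) = 0 with p, q, r of
   degree at most 2. If x2 were not in K(x1), the discriminant q^2 - 4pr, of degree at most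
   4, would be f1 times a square, which is impossible for f1 separable of degree at least 5.
   So K(x1) = K(x2), x2 is a Moebius transform of x1, and comparing parities of orders of
   vanishing in f2(x2) = B^2 f1(x1) shows that the transformation maps branch points
   (including infinity) to branch points.

   A cluster picture only depends on the ultrametric w(r, r') = v(r - r') on the roots. A
   Moebius transformation changes w into w - e(r) - e(r') for some function e. When e takes
   two values this is, up to a shift, a redistribution (d), and a general e is reached one
   value at a time. Steps (b) and (c) allow one to assume the number of points even: the
   added root stands for infinity. *)
Require Import Defs.
From HB Require Import structures.
From mathcomp Require Import all_boot all_order all_algebra.
From mathcomp Require Import separable.
From mathcomp Require Import ring lra boolp.
From Stdlib Require Import Relations.Relation_Operators.
Import Order.TTheory GRing.Theory Num.Theory.
Local Open Scope ring_scope.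

Set Implicit Arguments.
Unset Strict Implicit.
Unset Printing Implicit Defensive.

(** * Cluster pictures of ultrametrics *)

Section UltrametricPictures.

Variable T : finType.
Implicit Types (w : T -> T -> rat) (s t : {set T}) (d : rat).

Definition ultrametric w :=
  (forall a b, w a b = w b a) /\
  (forall a b c, a != b -> b != c -> a != c -> w a b <= w a c \/ w b c <= w a c).

Definition cluster w s :=
  (s != set0) && [forall a in s, forall b in s, forall c,
    (a != b) && (c \notin s) ==> (w a c < w a b)].

Definition is_depth w s d :=
  (forall a b, a \in s -> b \in s -> a != b -> d <= w a b) /\
  exists a b, [/\ a \in s, b \in s, a != b & d = w a b].

Definition depth w s :=
  if [pick p : T * T | [&& p.1 \in s, p.2 \in s, p.1 != p.2
        & [forall a in s, forall b in s, (a != b) ==> (w p.1 p.2 <= w a b)]]]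
  is Some p then w p.1 p.2 else 0.

Lemma clusterP w s :
  reflect (s != set0 /\ forall a b c, a \in s -> b \in s -> a != b -> c \notin s ->
             w a c < w a b) (cluster w s).
Proof.
apply: (iffP andP) => -[s0 H]; split=> //.
  move=> a b c sa sb ab sc.
  move/forall_inP/(_ _ sa)/forall_inP/(_ _ sb)/forallP/(_ c): H.
  by rewrite ab sc.
apply/forall_inP => a sa; apply/forall_inP => b sb; apply/forallP => c.
by apply/implyP => /andP[ab sc]; apply: H.
Qed.

Lemma depthP w s : (1 < #|s|)%N -> is_depth w s (depth w s).
Proof.
case/card_gt1P => x [y [sx sy xy]].
pose P (p : T * T) := [&& p.1 \in s, p.2 \in s & p.1 != p.2].
have Pxy : P (x, y) by rewrite /P /= sx sy.
rewrite /depth; case: pickP => [p /and4P[p1 p2 p12 pm] | none].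
  split; last by exists p.1, p.2.
  move=> a b sa sb ab.
  by move/forall_inP/(_ _ sa)/forall_inP/(_ _ sb)/implyP/(_ ab): pm.
case: (Order.TotalTheory.arg_minP (fun p : T * T => w p.1 p.2) Pxy) => p /and3P[p1 p2 p12] pm.
have := none p; rewrite /= p1 p2 p12 /=.
case/negP; apply/forall_inP => a sa; apply/forall_inP => b sb.
by apply/implyP => ab; apply: (pm (a, b)); rewrite /P /= sa sb.
Qed.

Lemma is_depth_uniq w s d d' : is_depth w s d -> is_depth w s d' -> d = d'.
Proof.
move=> [lo [a [b [sa sb ab da]]]] [lo' [a' [b' [sa' sb' ab' da']]]].
by apply/le_anti/andP; split; [rewrite da'; apply: lo | rewrite da; apply: lo'].
Qed.

Lemma depth_eq w s d : (1 < #|s|)%N -> is_depth w s d -> depth w s = d.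
Proof. by move=> s1 sd; apply: is_depth_uniq (depthP w s1) sd. Qed.

Definition pic_of w := CPic [set s | cluster w s] (depth w).

End UltrametricPictures.

Definition pictures (A : cpic) (w : cp_T A -> cp_T A -> rat) :=
  (forall s, (s \in cp_S A) = cluster w s) /\
  (forall s, s \in cp_S A -> (1 < #|s|)%N -> is_depth w s (cp_d A s)).

Lemma pic_ofP (T : finType) (w : T -> T -> rat) : @pictures (pic_of w) w.
Proof. by split=> s; [rewrite inE | move=> _; apply: depthP]. Qed.

Lemma pictures_valid (A : cpic) w : (0 < #|cp_T A|)%N -> @pictures A w -> cp_valid A.
Proof.
move=> A0 [clA dA]; split.
- move=> x; rewrite clA; apply/clusterP; split; first by rewrite -card_gt0 cards1.
  by move=> a b c /set1P-> /set1P->; rewrite eqxx.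
- rewrite clA; apply/clusterP; split; first by rewrite -card_gt0 cardsT.
  by move=> a b c _ _ _; rewrite inE.
- by move=> s; rewrite clA => /clusterP[].
- move=> s t; rewrite !clA => /clusterP[s0 cs] /clusterP[t0 ct].
  have [//|/=] := boolP [disjoint s & t].
  case/pred0Pn => a /andP[/= sa ta].
  have [//|/=] := boolP (s \subset t); case/subsetPn => b sb tb.
  apply/subsetP => c tc; apply/negPn/negP => sc.
  have ab : a != b by apply: contraNneq tb => <-.
  have ac : a != c by apply: contraNneq sc => <-.
  by have := lt_trans (cs a b c sa sb ab sc) (ct a c b ta tc ac tb); rewrite ltxx.
- move=> s t Ss St s1 t1 /properP[st [c sc tc]].
  have [lo _] := dA s Ss s1; have [_ [a [b [ta tb ab ->]]]] := dA t St t1.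
  have /clusterP[_ ct] : cluster w t by rewrite -clA.
  have ac : a != c by apply: contraNneq tc => <-.
  exact: le_lt_trans (lo a c (subsetP st _ ta) sc ac) (ct a b c ta tb ab tc).
Qed.

Lemma pic_of_valid (U : finType) (u : U -> U -> rat) : (0 < #|U|)%N ->
  cp_valid (pic_of u).
Proof. by move=> U0; apply: pictures_valid (pic_ofP u). Qed.

Section Shift.

Variables (A B : cpic) (w : cp_T A -> cp_T A -> rat) (w' : cp_T B -> cp_T B -> rat).
Variables (h : cp_T A -> cp_T B) (m : rat).
Hypotheses (hbij : bijective h) (Aw : pictures w) (Bw : pictures w').
Hypothesis hw : forall a b, a != b -> w' (h a) (h b) = w a b + m.

Lemma pictures_shift : cp_shift_iso m A B.
Proof.
have hI := bij_inj hbij; have [g hK gK] := hbij.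
have cl s : (s \in cp_S A) = (h @: s \in cp_S B).
  rewrite (proj1 Aw) (proj1 Bw); apply/clusterP/clusterP => -[s0 cs]; split.
  - by apply: contraNneq s0 => /eqP; rewrite imset_eq0.
  - move=> _ _ c /imsetP[a sa ->] /imsetP[b sb ->]; rewrite (inj_eq hI) => ab.
    rewrite -(gK c) mem_imset // => sc.
    have ac : a != g c by apply: contraNneq sc => <-.
    by rewrite !hw // ltrD2r cs.
  - by apply: contraNneq s0 => ->; rewrite imset0.
  - move=> a b c sa sb ab sc.
    have ac : a != c by apply: contraNneq sc => <-.
    by rewrite -(ltrD2r m) -!hw // cs ?mem_imset ?(inj_eq hI).
exists h; split=> // s Ss s1.
have s1' : (1 < #|h @: s|)%N by rewrite card_imset.
have Ss' : h @: s \in cp_S B by rewrite -cl.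
apply: is_depth_uniq (proj2 Bw _ Ss' s1') _.
have [lo [a [b [sa sb ab dE]]]] := proj2 Aw _ Ss s1; split.
  move=> _ _ /imsetP[a' sa' ->] /imsetP[b' sb' ->]; rewrite (inj_eq hI) => ab'.
  by rewrite hw // lerD2r lo.
by exists (h a), (h b); rewrite !mem_imset // (inj_eq hI) hw // dE.
Qed.

Lemma pictures_shift_step : (0 < #|cp_T A|)%N -> cp_step A B.
Proof.
move=> A0; have B0 : (0 < #|cp_T B|)%N by rewrite -(bij_eq_card hbij).
split; [exact: pictures_valid Aw | exact: pictures_valid Bw |].
by apply: Or41; exists m; apply: pictures_shift.
Qed.

End Shift.

Lemma cp_iso_refl (A : cpic) : cp_iso A A.
Proof.
exists id; split; first by exists id.
  by move=> s; rewrite imset_id.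
by move=> s _ _; rewrite imset_id addr0.
Qed.

Section AddRoot.

Variables (T : finType) (w : T -> T -> rat).

Definition add_point (p q : option T) : rat :=
  if (p, q) is (Some a, Some b) then w a b else depth w setT.

Hypothesis T1 : (1 < #|T|)%N.

Let dT : is_depth w setT (depth w setT).
Proof. by apply: depthP; rewrite cardsT. Qed.

Lemma add_point_ultrametric : ultrametric w -> ultrametric add_point.
Proof.
move=> [sym tri]; split; first by case=> [a|] [b|] //=; apply: sym.
have lo a b : a != b -> depth w setT <= w a b by apply: (proj1 dT); rewrite inE.
case=> [a|] [b|] [c|] //= ab bc ac;
  by [apply: tri | left | right | left; apply: lo | right; apply: lo].
Qed.

Lemma cluster_add_point (t : {set option T}) :
  cluster add_point t =
  [|| t == [set None], t == setT
    | [&& None \notin t, cluster w (Some @^-1: t) & Some @^-1: t != setT]].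
Proof.
have [lo [x [y [_ _ xy dxy]]]] := dT.
apply/clusterP/or3P => [[t0 ct]|].
  have [tN | tN] := boolP (None \in t).
    have [tE | tE] := eqVneq t [set None]; first by apply: Or31.
    apply: Or32; have [a ta] : exists a, Some a \in t.
      have [q tq qN] : exists2 q, q \in t & q != None.
        apply/exists_inP; rewrite -negb_forall_in; apply: contraNN tE => /forall_inP H.
        by rewrite eqEsubset sub1set tN andbT; apply/subsetP => q /H; rewrite inE.
      by case: q tq qN => // a ta _; exists a.
    rewrite -subTset; apply/subsetP => -[c|] // _; apply/negPn/negP => tc.
    by have := ct None (Some a) (Some c) tN ta isT tc; rewrite ltxx.
  apply: Or33; apply/and3P; split=> //.
    apply/clusterP; split.
      have [[a|] ta] := set0Pn _ t0; last by rewrite ta in tN.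
      by apply/set0Pn; exists a; rewrite inE.
    by move=> a b c; rewrite !inE => ta tb ab tc; apply: (ct (Some a) (Some b) (Some c)).
  apply/eqP => tT.
  have mem a : Some a \in t by have := in_setT a; rewrite -tT inE.
  have := ct (Some x) (Some y) None (mem x) (mem y) xy tN.
  by rewrite /add_point /= dxy ltxx.
case=> [/eqP-> | /eqP-> | /and3P[tN /clusterP[t0 ct] tT]].
- split; first by rewrite -card_gt0 cards1.
  by move=> a b c /set1P-> /set1P->; rewrite eqxx.
- split; first by apply/set0Pn; exists None.
  by move=> a b c _ _ _; rewrite inE.
- split.
    by have [a] := set0Pn _ t0; rewrite inE => ta; apply/set0Pn; exists (Some a).
  case=> [a|]; last by rewrite (negbTE tN).
  case=> [b|]; last by rewrite (negbTE tN).
  case=> [c|] ta tb ab tc; rewrite /add_point /=; first by apply: ct; rewrite ?inE.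
  have [c tc'] : exists c, c \notin Some @^-1: t.
    apply/existsP; rewrite -negb_forall; apply: contraNN tT => /forallP H.
    by apply/eqP/setP => c; rewrite H inE.
  have tc'' : Some c \notin t by rewrite inE in tc'.
  have ac : a != c by apply: contraNneq tc'' => <-.
  by apply: le_lt_trans (lo a c _ _ ac) _; rewrite ?inE //; apply: ct; rewrite ?inE.
Qed.

Lemma depth_add_point (s : {set T}) : (1 < #|s|)%N ->
  depth add_point (Some @: s) = depth w s.
Proof.
have SI : injective (@Some T) by move=> a b [].
move=> s1; apply: depth_eq; first by rewrite card_imset.
have [lo [a [b [sa sb ab dE]]]] := depthP w s1.
split; last by exists (Some a), (Some b); rewrite !mem_imset.
by move=> _ _ /imsetP[a' sa' ->] /imsetP[b' sb' ->] ab'; apply: lo.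
Qed.

Lemma depth_add_pointT : depth add_point setT = depth w setT.
Proof.
apply: depth_eq; first by rewrite cardsT card_option ltnS ltnW.
have [lo [x [y [_ _ xy dxy]]]] := dT; split.
  case=> [a|] [b|] //= _ _ ab; exact: lo.
by exists None, (Some x); rewrite !inE.
Qed.

Lemma preim_Some_imset (s : {set T}) : Some @^-1: (Some @: s) = s.
Proof. by apply/setP => a; rewrite inE mem_imset // => x y []. Qed.

Lemma None_notin_imset (s : {set T}) : None \notin Some @: s.
Proof. by apply/imsetP => -[]. Qed.

Lemma add_root_step : odd #|T| -> cp_step (pic_of w) (pic_of add_point).
Proof.
move=> oT; split; [apply: pic_of_valid; exact: ltnW | apply: pic_of_valid |].
  by rewrite card_option.
apply: Or42; split=> //; exists (@Some T), None; split=> //.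
- by move=> a b [].
- by case=> // a _; exists a.
- by move=> t; rewrite !inE cluster_add_point.
- split; first exact: depth_add_pointT.
  by move=> s _ _ s1; apply: depth_add_point.
Qed.

Lemma remove_root_step : odd #|T| -> cp_step (pic_of add_point) (pic_of w).
Proof.
move=> oT; split.
- by apply: pic_of_valid; rewrite card_option.
- by apply: pic_of_valid; exact: ltnW.
apply: Or43; split; first by rewrite /= card_option /= oT.
exists (@Some T), None; split.
- split; first by move=> a b [].
  by split=> // -[] // a _; exists a.
- split; first by rewrite inE cluster_add_point eqxx.
  move=> t; rewrite inE cluster_add_point => + Nt tT.
  case/or3P => [/eqP tE | /eqP tE | /and3P[tN _ _]].
  + by rewrite tE properxx in Nt.
  + by rewrite tE properxx in tT.
  + by move/proper_sub: Nt; rewrite sub1set (negbTE tN).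
- rewrite inE cluster_add_point !inE eqxx /=.
  have -> : (~: [set None] == [set None :> option T]) = false.
    by apply/eqP => /setP/(_ None); rewrite !inE.
  have -> : (~: [set None] == [set: option T]) = false.
    by apply/eqP => /setP/(_ None); rewrite !inE.
  rewrite /=; apply/nandP; right; rewrite negbK; apply/eqP/setP => a.
  by rewrite !inE.
- split.
    move=> t; rewrite !inE cluster_add_point preim_Some_imset None_notin_imset /=.
    have -> : (Some @: t == [set None]) = false.
      by apply/eqP => E; have := None_notin_imset t; rewrite E set11.
    have -> : (Some @: t == setT) = false.
      by apply/eqP => E; have := None_notin_imset t; rewrite E inE.
    have [->|_] := eqVneq t setT; last by rewrite andbT.
    apply/clusterP; split; last by move=> a b c _ _ _; rewrite inE.
    by rewrite -card_gt0 cardsT ltnW.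
  split; first by rewrite /= depth_add_pointT.
  by move=> t _ _ t1; rewrite /= depth_add_point.
Qed.

End AddRoot.

(* A cluster other than the whole of one side lies within one side, where [u] and [u'] differ by a
   constant. *)
Lemma cluster_two_sides (T : finType) (u u' : T -> T -> rat) (side : pred T)
    (g : rat) (k : bool -> rat) (t : {set T}) :
  (forall a b, side a != side b -> u a b = g) ->
  (forall a b, side a != side b -> u' a b = g) ->
  (forall a b, side a = side b -> u' a b = u a b + k (side a)) ->
  (forall a b, a != b -> g <= u' a b) ->
  (forall x, t <> [set a | side a == side x]) ->
  cluster u t -> cluster u' t.
Proof.
move=> ug u'g uu' lo tside /clusterP[t0 ct]; apply/clusterP; split=> //.
move=> a b c ta tb ab tc.
have one_side x y : x \in t -> y \in t -> side x = side y.
  move=> tx ty; apply/eqP/negPn/negP => xy.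
  have xy' : x != y by apply: contraNneq xy => ->.
  have := ct x y c tx ty xy' tc.
  have := ct y x c ty tx; rewrite eq_sym => /(_ xy' tc).
  rewrite (ug x y) // (ug y x) 1?eq_sym //.
  have [xc|xc] := eqVneq (side x) (side c).
    by rewrite (ug y c) ?ltxx // -xc eq_sym.
  by rewrite (ug x c) ?ltxx.
have same c' : side a = side c' -> c' \notin t -> u' a c' < u' a b.
  by move=> ac' tc'; rewrite (uu' _ _ ac') (uu' _ _ (one_side _ _ ta tb)) ltrD2r; apply: ct.
have [ac|ac] := eqVneq (side a) (side c); first exact: same.
have [c' ac' tc'] : exists2 c', side a = side c' & c' \notin t.
  have /subsetPn[c'] : ~~ ([set x | side x == side a] \subset t).
    apply/negP => st; apply: (tside a); apply/eqP; rewrite eqEsubset st andbT.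
    by apply/subsetP => x tx; rewrite inE (one_side x a).
  by rewrite inE => /eqP E; exists c'.
rewrite (u'g a c) //; apply: le_lt_trans (same c' ac' tc'); apply: lo.
by apply: contraNneq tc' => <-.
Qed.

Section Redistribute.

Variables (T : finType) (w : T -> T -> rat) (s : {set T}) (g mu : rat).

Definition half_shift a := if a \in s then mu / 2 else - (mu / 2).
Definition redistributed a b := w a b - half_shift a - half_shift b.

Hypotheses (evT : ~~ odd #|T|) (s0 : s != set0) (sT : s != setT) (mu0 : 0 < mu).
Hypothesis sym : forall a b, w a b = w b a.
Hypothesis cross : forall a b, a \notin s -> b \in s -> w a b = g.
Hypothesis lo_in : forall a b, a \in s -> b \in s -> a != b -> g + mu <= w a b.
Hypothesis lo_out : forall a b, a \notin s -> b \notin s -> a != b -> g <= w a b.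

Let w2 := redistributed.

Let cross1 a b : (a \in s) != (b \in s) -> w a b = g.
Proof.
by case: (boolP (a \in s)) (boolP (b \in s)) => sa [] sb // _;
  [rewrite sym cross | rewrite cross].
Qed.

Let cross2 a b : (a \in s) != (b \in s) -> w2 a b = g.
Proof.
move=> ab; rewrite /w2 /redistributed cross1 // /half_shift.
by move: ab; case: (a \in s); case: (b \in s) => //= _; (have := mu0; lra).
Qed.

Let same2 a b : (a \in s) = (b \in s) -> w2 a b = w a b + (if a \in s then - mu else mu).
Proof.
by rewrite /w2 /redistributed /half_shift => <-; case: (a \in s) => /=; (have := mu0; lra).
Qed.

Let lo1 a b : a != b -> g <= w a b.
Proof.
move=> ab; have [E|E] := eqVneq (a \in s) (b \in s); last by rewrite cross1.
case: (boolP (a \in s)) E => sa /esym sb; last by apply: lo_out; rewrite ?sb.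
by have := lo_in sa sb ab; (have := mu0; lra).
Qed.

Let lo2 a b : a != b -> g <= w2 a b.
Proof.
move=> ab; have [E|E] := eqVneq (a \in s) (b \in s); last by rewrite cross2.
rewrite same2 //; have := lo1 ab.
case: (boolP (a \in s)) E => sa /esym sb; last by (have := mu0; lra).
by have := lo_in sa sb ab; (have := mu0; lra).
Qed.

Let ex_in : exists b, b \in s. Proof. exact/set0Pn. Qed.

Let ex_out : exists a, a \notin s.
Proof.
by move: sT; rewrite -subTset => /subsetPn[a _ sa]; exists a.
Qed.

Let T1 : (1 < #|[set: T]|)%N.
Proof.
have [b sb] := ex_in; have [a sa] := ex_out; apply/card_gt1P; exists a, b.
by rewrite !inE; split=> //; apply: contraNneq sa => ->.
Qed.

Let depth_full (u : T -> T -> rat) : (forall a b, a != b -> g <= u a b) ->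
  (forall a b, (a \in s) != (b \in s) -> u a b = g) -> depth u setT = g.
Proof.
move=> lo cr; apply: depth_eq => //; split=> [a b _ _|]; first exact: lo.
have [b sb] := ex_in; have [a sa] := ex_out; exists a, b; rewrite !inE; split=> //.
  by apply: contraNneq sa => ->.
by rewrite cr // sb (negbTE sa).
Qed.

Let cluster_w_s : cluster w s.
Proof.
apply/clusterP; split=> // a b c sa sb ab sc.
rewrite cross1; last by rewrite sa (negbTE sc).
by have := lo_in sa sb ab; (have := mu0; lra).
Qed.

Let cluster_w2_sc : cluster w2 (~: s).
Proof.
apply/clusterP; split=> [|a b c].
  by have [a sa] := ex_out; apply/set0Pn; exists a; rewrite inE.
rewrite !inE negbK => sa sb ab sc.
rewrite cross2; last by rewrite sc (negbTE sa).
rewrite same2; last by rewrite (negbTE sa) (negbTE sb).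
by rewrite (negbTE sa); have := lo_out sa sb ab; (have := mu0; lra).
Qed.

Let cluster_other t : t != s -> t != ~: s -> cluster w2 t = cluster w t.
Proof.
move=> /eqP ts /eqP tsc.
have nside x : t <> [set a | (a \in s) == (x \in s)].
  case: (x \in s) => E; [apply: ts | apply: tsc]; rewrite E; apply/setP => a;
  by rewrite !inE ?eqb_id ?eqbF_neg.
apply/idP/idP.
  apply: (@cluster_two_sides _ _ _ (mem s) g (fun b => if b then mu else - mu)) => //.
  by move=> a b E; rewrite same2 // [mem s a]/=; case: (a \in s) => /=; (have := mu0; lra).
apply: (@cluster_two_sides _ _ _ (mem s) g (fun b => if b then - mu else mu)) => //.
Qed.

Let is_depth_shift (t : {set T}) (b : bool) d : (forall a, a \in t -> (a \in s) = b) ->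
  is_depth w t d -> is_depth w2 t (d + if b then - mu else mu).
Proof.
move=> tb [lo [x [y [tx ty xy dE]]]].
have w2E x' y' : x' \in t -> y' \in t -> w2 x' y' = w x' y' + if b then - mu else mu.
  by move=> tx' ty'; rewrite same2 ?tb.
split; last by exists x, y; rewrite w2E // dE.
by move=> x' y' tx' ty' xy'; rewrite w2E // lerD2r lo.
Qed.

Lemma redistribute_step : cp_step (pic_of w) (pic_of w2).
Proof.
have T0 : (0 < #|T|)%N by rewrite -cardsT ltnW.
split; [exact: pic_of_valid | exact: pic_of_valid |].
apply: Or44; exists (- mu); split=> //; exists s => /=.
have dRE : depth w setT = g by apply: depth_full.
rewrite dRE !inE.
have ssc : s != ~: s.
  by have [b sb] := ex_in; apply/eqP => /setP/(_ b); rewrite inE sb.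
have out_depth : (1 < #|~: s|)%N -> g <= depth w (~: s).
  move=> sc1; have [_ [a [b [sa sb ab ->]]]] := depthP w sc1.
  exact: lo1.
split.
- split=> //; split=> // t; rewrite inE => ct st tT.
  have [_ [b sb tb]] := properP tT.
  have [st' [a ta sa]] := properP st.
  have [b' sb'] := ex_in.
  have /clusterP[_ H] := ct.
  have ab' : a != b' by apply: contraNneq sa => ->.
  have [sB|sB] := boolP (b \in s); first by rewrite (subsetP st') in tb.
  have := H b' a b (subsetP st' _ sb') ta; rewrite eq_sym => /(_ ab' tb).
  by rewrite !cross1 ?ltxx ?sb' ?(negbTE sa) ?(negbTE sB).
- move=> s1; have [_ [a [b [sa sb ab ->]]]] := depthP w s1.
  by have := lo_in sa sb ab; (have := mu0; lra).
- case: ifP => _; last by (have := mu0; lra).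
  by move=> /out_depth; (have := mu0; lra).
exists id; split.
- by exists id.
- move=> t; rewrite imset_id inE.
  have [->|ts] := eqVneq t s.
    apply/idP/idP.
      move=> /clusterP[_ H]; have [//|/= s1] := eqVneq #|s| 1%N.
      have s1' : (1 < #|s|)%N by rewrite ltn_neqAle eq_sym s1 card_gt0.
      have [_ [a [b [sa sb ab ->]]]] := depthP w s1'.
      have [c sc] := ex_out.
      have := H a b c sa sb ab sc; rewrite cross2; last by rewrite sa (negbTE sc).
      by rewrite same2 ?sa ?sb // => /gt_eqF->.
    case/orP => [/cards1P[x ->]|].
      apply/clusterP; split; first by rewrite -card_gt0 cards1.
      by move=> a b c /set1P-> /set1P->; rewrite eqxx.
    move=> ne; apply/clusterP; split=> // a b c sa sb ab sc.
    rewrite cross2; last by rewrite sa (negbTE sc).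
    rewrite same2 ?sa ?sb //.
    have s1 : (1 < #|s|)%N by apply/card_gt1P; exists a, b.
    have [lo [a' [b' [sa' sb' ab' E]]]] := depthP w s1.
    have := lo a b sa sb ab; have := lo_in sa' sb' ab'; rewrite -E.
    by move: ne; rewrite neq_lt => /orP[]; (have := mu0; lra).
  have [->|tsc] := eqVneq t (~: s); last by rewrite inE cluster_other.
  rewrite cluster_w2_sc; apply/esym.
  have [//|/= s1] := eqVneq #|~: s| 1%N.
  have sc1 : (1 < #|~: s|)%N.
    rewrite ltn_neqAle eq_sym s1 card_gt0.
    by have [a sa] := ex_out; apply/set0Pn; exists a; rewrite inE.
  have := out_depth sc1.
  by case: ifP => _ ?; rewrite gt_eqF //; (have := mu0; lra).
- by rewrite imset_id (depth_full lo2 cross2).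
- move=> t ts t1 ct ct'; rewrite imset_id; apply: depth_eq => //.
  apply: (@is_depth_shift t true); last exact: depthP.
  exact: subsetP.
- move=> t ts t1; rewrite imset_id inE opprK => ct.
  apply: depth_eq => //.
  apply: (@is_depth_shift t false).
    by move=> a /(subsetP ts); rewrite inE => /negbTE.
  rewrite inE; case: ifP => [_|nct]; first exact: depthP.
  have tE : t = ~: s.
    apply/eqP; apply: contraFT nct => tsc; rewrite -cluster_other //.
    apply: contraTneq t1 => tE; have [b sb] := ex_in.
    by have := subsetP ts b; rewrite tE inE sb => /(_ isT).
  subst t; have [lo [a [b [sa sb ab E]]]] := depthP w t1.
  have -> : g = depth w (~: s); last exact: depthP.
  apply/le_anti; rewrite out_depth //= leNgt; apply: contraFN nct => gd.
  apply/clusterP; split; first by rewrite -card_gt0 (ltn_trans _ t1).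
  move=> x y z sx sy xy; rewrite inE negbK => sz.
  rewrite cross1; first exact: lt_le_trans gd (lo x y sx sy xy).
  by rewrite sz; move: sx; rewrite inE => /negbTE->.
Qed.

End Redistribute.

Lemma two_smallest_equal (x y z : rat) :
  x <= y \/ z <= y -> y <= x \/ z <= x -> x <= z \/ y <= z ->
  [\/ x = y /\ x <= z, x = z /\ x <= y | y = z /\ y <= x].
Proof.
case=> ? [] ? [] ?; try by [apply: Or31; split; lra | apply: Or32; split; lra
  | apply: Or33; split; lra].
Qed.

Section Triples.

Variables (T : finType) (w w' : T -> T -> rat) (e : T -> rat).
Hypotheses (uw : ultrametric w) (uw' : ultrametric w').
Hypothesis ww' : forall a b, a != b -> w' a b = w a b - e a - e b.

Let tri (u : T -> T -> rat) : ultrametric u -> forall a b c, a != b -> b != c -> a != c ->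
  [\/ u a b = u a c /\ u a b <= u b c, u a b = u b c /\ u a b <= u a c
    | u a c = u b c /\ u a c <= u a b].
Proof.
move=> [sym t] a b c ab bc ac; apply: two_smallest_equal; first exact: t.
  by rewrite (sym b c); apply: t; rewrite // eq_sym.
by rewrite (sym a b); apply: t; rewrite // eq_sym.
Qed.

Lemma triple_below a b c : b != c -> e a < e b -> e b <= e c ->
  w a b = w a c /\ w a b - e a + e b <= w b c.
Proof.
move=> bc eab ebc.
have ab : a != b by apply: contraTneq eab => ->; rewrite ltxx.
have ac : a != c by apply: contraTneq (lt_le_trans eab ebc) => ->; rewrite ltxx.
have := tri uw ab bc ac; have := tri uw' ab bc ac; rewrite !ww' //.
move: (w a b) (w a c) (w b c) (e a) (e b) (e c) eab ebc => x y z p q r.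
by move=> pq qr [] [? ?] [] [? ?]; split; lra.
Qed.

Lemma triple_above a b c : a != b -> e a = e b -> e b < e c ->
  w a c = w b c /\ w a c <= w a b.
Proof.
move=> ab eab ebc.
have bc : b != c by apply: contraTneq ebc => ->; rewrite ltxx.
have ac : a != c by apply: contraTneq ebc => <-; rewrite eab ltxx.
have := tri uw ab bc ac; have := tri uw' ab bc ac; rewrite !ww' //.
move: (w a b) (w a c) (w b c) (e a) (e b) (e c) eab ebc => x y z p q r.
by move=> pq qr [] [? ?] [] [? ?]; split; lra.
Qed.

End Triples.

Lemma redistributed_ultrametric (T : finType) (w : T -> T -> rat) (s : {set T}) (g mu : rat) :
  0 < mu -> ultrametric w ->
  (forall a b, a \notin s -> b \in s -> w a b = g) ->
  (forall a b, a \in s -> b \in s -> a != b -> g + mu <= w a b) ->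
  (forall a b, a \notin s -> b \notin s -> a != b -> g <= w a b) ->
  ultrametric (redistributed w s mu).
Proof.
move=> mu0 [sym tri] cross lo_in lo_out; split=> [a b|a b c ab bc ac].
  by rewrite /redistributed sym; lra.
have := tri a b c ab bc ac; rewrite /redistributed /half_shift.
case: (boolP (a \in s)) (boolP (b \in s)) (boolP (c \in s)) => sa [] sb [] sc;
  try by case=> ?; [left|right]; lra.
- by move=> _; left; have := lo_in a c sa sc ac; rewrite (sym a b) (cross b a) //; lra.
- by move=> _; left; rewrite (sym a b) (sym a c) (cross b a) // (cross c a) //; lra.
- by move=> _; right; rewrite !cross //; lra.
Qed.

(* Geometrically [e r] is [v (r - c)] up to a constant, with [c] the point sent to infinity; each
   redistribution pushes the root of the tree of clusters one vertex further towards [c]. *)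
Lemma reroot (T : finType) (w w' : T -> T -> rat) (e : T -> rat) :
  ~~ odd #|T| -> (0 < #|T|)%N -> ultrametric w -> ultrametric w' ->
  (forall a b, a != b -> w' a b = w a b - e a - e b) ->
  clos_refl_trans cpic cp_step (pic_of w) (pic_of w').
Proof.
move=> evT T0 + uw'; have [p0 _] : exists p0, p0 \in [set: T].
  by apply/set0Pn; rewrite -card_gt0 cardsT.
have [n] := ubnP #|[set a | [exists p, e p < e a]]|.
elim: n w e => // n IH w e; rewrite ltnS => le_n uw ww'.
case: (Order.TotalTheory.arg_minP e (isT : predT p0)) => p _ pmin.
pose s := [set a | e p < e a].
have sE : [set a | [exists p, e p < e a]] = s.
  apply/setP => a; rewrite !inE; apply/existsP/idP => [[q]|?]; last by exists p.
  exact/le_lt_trans/pmin.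
have eout a : a \notin s -> e a = e p.
  by rewrite inE -leNgt => ?; apply/le_anti; rewrite pmin // andbT.
have [s0|[q0 sq0]] := set_0Vmem s.
  have ec a : e a = e p by apply: eout; rewrite s0 inE.
  apply: rt_step; apply: (@pictures_shift_step (pic_of w) (pic_of w') w w' id (- 2 * e p)).
  - by exists id.
  - exact: pic_ofP.
  - exact: pic_ofP.
  - by move=> a b ab; rewrite ww' // !ec; lra.
  - exact: T0.
case: (Order.TotalTheory.arg_minP e sq0) => q sq qmin.
have {}sq : q \in s := sq.
have {}qmin b : b \in s -> e q <= e b := qmin b.
have pq : e p < e q by move: sq; rewrite inE.
have ps : p \notin s by rewrite inE ltxx.
pose mu := e q - e p; pose g := w p q.
have mu0 : 0 < mu by rewrite subr_gt0.
have [sym tri] := uw.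
have crossp b : b \in s -> w p b = g.
  move=> sb; have [->//|bq] := eqVneq b q.
  have := qmin b sb; rewrite eq_sym in bq => qb.
  by have [] := triple_below uw uw' ww' bq pq qb.
have cross a b : a \notin s -> b \in s -> w a b = g.
  move=> sa sb; rewrite -(crossp b sb).
  have [->//|ap] := eqVneq a p.
  have pb : e p < e b by move: sb; rewrite inE.
  by have [] := triple_above uw uw' ww' ap (eout a sa) pb.
have lo_in a b : a \in s -> b \in s -> a != b -> g + mu <= w a b.
  wlog: a b / e a <= e b => [H|ab] sa sb nab.
    have [ab|/ltW ba] := leP (e a) (e b); first exact: H.
    by rewrite sym; apply: H; rewrite // eq_sym.
  have := qmin a sa; have sa' : e p < e a by move: sa; rewrite inE.
  have [_] := triple_below uw uw' ww' nab sa' ab; rewrite crossp // /mu.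
  lra.
have lo_out a b : a \notin s -> b \notin s -> a != b -> g <= w a b.
  move=> sa sb ab; rewrite -(cross a q sa sq).
  have eab : e a = e b by rewrite !eout.
  have ebq : e b < e q by rewrite eout.
  by have [] := triple_above uw uw' ww' ab eab ebq.
have s0 : s != set0 by apply/set0Pn; exists q.
have sT : s != setT by apply: contraNneq ps => ->; rewrite inE.
have st := redistribute_step evT s0 sT mu0 sym cross lo_in lo_out.
apply: rt_trans (rt_step _ _ _ _ st) _.
have uw2 := redistributed_ultrametric mu0 uw cross lo_in lo_out.
apply: (IH _ (fun a => e a - half_shift s mu a)) => //; last first.
  by move=> a b ab; rewrite /redistributed ww' //; lra.
apply: leq_trans le_n; apply: proper_card; rewrite sE; apply/properP; split.
  apply/subsetP => a; rewrite !inE => /existsP[b]; rewrite /half_shift.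
  apply: contraTT; rewrite -leNgt => ea; rewrite -leNgt.
  have -> : a \in s = false by rewrite inE ltNge ea.
  have := pmin b isT; case: ifP => sb; last by lra.
  by have := qmin b sb; rewrite /mu; lra.
exists q => //; rewrite inE; apply/existsPn => b; rewrite -leNgt /half_shift sq.
case: ifP => sb; first by have := qmin b sb; lra.
by rewrite (eout b) ?sb // /mu; lra.
Qed.

(** * Roots, valuations and Moebius transformations *)

Section Valuation.

Variables (L : fieldType) (v : L -> rat).
Hypothesis vP : is_valuation v.

Lemma valM a b : a != 0 -> b != 0 -> v (a * b) = v a + v b.
Proof. exact: (proj1 vP). Qed.

Lemma val1 : v 1 = 0.
Proof. by have := valM (oner_neq0 L) (oner_neq0 L); rewrite mulr1; lra. Qed.

Lemma valV a : a != 0 -> v a^-1 = - v a.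
Proof.
move=> a0; have := valM a0 (invr_neq0 a0).
by rewrite mulfV // val1; lra.
Qed.

Lemma valf a b : a != 0 -> b != 0 -> v (a / b) = v a - v b.
Proof. by move=> a0 b0; rewrite valM ?invr_neq0 // valV. Qed.

Lemma valN a : v (- a) = v a.
Proof.
have [->|a0] := eqVneq a 0; first by rewrite oppr0.
have N1 : (-1 : L) != 0 by rewrite oppr_eq0 oner_neq0.
have := valM N1 N1; rewrite mulrNN mulr1 val1.
have -> : v (- a) = v (-1) + v a by rewrite -valM // mulN1r.
lra.
Qed.

Lemma val_distC a b : v (a - b) = v (b - a).
Proof. by rewrite -valN opprB. Qed.

Definition val_ge (d : rat) (a : L) := (a == 0) || (d <= v a).

Lemma val_geD d a b : val_ge d a -> val_ge d b -> val_ge d (a + b).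
Proof.
rewrite /val_ge; have [->|a0] := eqVneq a 0; first by rewrite add0r.
have [->|b0] := eqVneq b 0; first by rewrite addr0 (negbTE a0).
have [//|ab0 /= da db] := eqVneq (a + b) 0.
by case: (proj2 vP a b a0 b0 ab0) => [|] /(le_trans _); apply.
Qed.

Lemma val_geN d a : val_ge d (- a) = val_ge d a.
Proof. by rewrite /val_ge oppr_eq0 valN. Qed.

Section Roots.

Variables (T : finType) (rho : T -> L).
Hypothesis rhoI : injective rho.

Definition root_dist a b := v (rho a - rho b).

Let subr0 a b : a != b -> rho a - rho b != 0.
Proof. by move=> ab; rewrite subr_eq0 (inj_eq rhoI). Qed.

Lemma root_dist_ultrametric : ultrametric root_dist.
Proof.
split=> [a b|a b c ab bc ac]; first exact: val_distC.
have E : (rho a - rho b) + (rho b - rho c) = rho a - rho c by ring.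
have := proj2 vP _ _ (subr0 ab) (subr0 bc); rewrite E; apply; exact: subr0.
Qed.

Lemma cluster_disc (s : {set T}) :
  cluster root_dist s <-> (s != set0 /\ exists (z : L) (d : rat),
     forall a, (a \in s) = (rho a == z) || (d <= v (rho a - z))).
Proof.
split=> [/clusterP[s0 cs]|[s0 [z [d sE]]]]; last first.
  have mem a : (a \in s) = val_ge d (rho a - z) by rewrite sE /val_ge subr_eq0.
  apply/clusterP; split=> // a b c sa sb ab sc; rewrite ltNge.
  apply: contra sc => le_ac.
  have dab : d <= v (rho a - rho b).
    have : val_ge d ((rho a - z) - (rho b - z)) by apply: val_geD; rewrite ?val_geN -?mem.
    have -> : (rho a - z) - (rho b - z) = rho a - rho b by ring.
    by rewrite /val_ge (negbTE (subr0 ab)).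
  rewrite mem; have -> : rho c - z = (rho a - z) - (rho a - rho c) by ring.
  apply: val_geD; first by rewrite -mem.
  by rewrite val_geN /val_ge (le_trans dab le_ac) orbT.
split=> //; have [s1|s1] := leqP #|s| 1.
  have /cards1P[x sE] : #|s| == 1%N by rewrite eqn_leq s1 card_gt0.
  exists (rho x), (1 + \sum_a `|root_dist a x|) => a.
  rewrite sE inE (inj_eq rhoI); have [//|ax /=] := eqVneq a x.
  apply/esym/negbTE; rewrite -ltNge (bigD1 a) //= -/(root_dist a x).
  have : 0 <= \sum_(i | i != a) `|root_dist i x| by apply: sumr_ge0.
  by have := ler_norm (root_dist a x); lra.
have [lo [x [y [sx sy xy dE]]]] := depthP root_dist s1.
exists (rho x), (depth root_dist s) => a; rewrite (inj_eq rhoI).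
have [->//|ax /=] := eqVneq a x.
apply/idP/idP => [sa|]; first exact: (lo a x).
by apply: contraTT => sa; rewrite -ltNge dE val_distC; apply: cs.
Qed.

End Roots.

(* Valuation of the determinant formed by the homogeneous coordinates [(z : 1)] and [(1 : 0)]. *)
Definition proj_val (P Q : option L) : rat :=
  if (P, Q) is (Some z, Some z') then v (z - z') else 0.

Section Moebius.

Variables (a b c d : L).

Definition moebius (P : option L) : option L :=
  match P with
  | Some z => if c * z + d == 0 then None else Some ((a * z + b) / (c * z + d))
  | None => if c == 0 then None else Some (a / c)
  end.

Definition moebius_weight (P : option L) : rat :=
  match P with
  | Some z => if c * z + d == 0 then v (a * z + b) else v (c * z + d)
  | None => if c == 0 then v a else v c
  end.

Hypothesis det : a * d - b * c != 0.

Let pole_num z : c * z + d = 0 -> a * z + b != 0.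
Proof.
move=> E; apply: contraNneq det => E'.
have [c0|c0] := eqVneq c 0.
  by rewrite c0 mul0r add0r in E; rewrite E c0 !mulr0 subr0.
have zE : z = - d / c.
  by apply: (mulfI c0); rewrite mulrCA mulfV // mulr1; apply/eqP; rewrite -addr_eq0 E.
by rewrite -(mulr0 (- c)) -E' zE; apply/eqP; field.
Qed.

Let c0_neq : c = 0 -> (a != 0) /\ (d != 0).
Proof.
by move=> c0; move: det; rewrite c0 mulr0 subr0 mulf_eq0 negb_or => /andP[].
Qed.

Lemma proj_val_moebius P Q : P != Q ->
  proj_val (moebius P) (moebius Q) =
  proj_val P Q + v (a * d - b * c) - moebius_weight P - moebius_weight Q.
Proof.
case: P Q => [z|] [z'|] //; rewrite /proj_val /=.
- rewrite (inj_eq Some_inj) => zz'; have zz0 : z - z' != 0 by rewrite subr_eq0.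
  case: (eqVneq (c * z + d) 0) => E; case: (eqVneq (c * z' + d) 0) => E'.
  + have c0 : c = 0.
      apply: (mulIf zz0); have -> : c * (z - z') = (c * z + d) - (c * z' + d) by ring.
      by rewrite E E' subrr mul0r.
    by rewrite c0 mul0r add0r in E; move: (proj2 (c0_neq c0)); rewrite E eqxx.
  + rewrite -!valM // ?pole_num //.
    have -> : (z - z') * (a * d - b * c) =
        (a * z + b) * (c * z' + d) - (a * z' + b) * (c * z + d) by ring.
    rewrite E mulr0 subr0 valM ?pole_num //; lra.
  + rewrite -!valM // ?pole_num //.
    have -> : (z - z') * (a * d - b * c) =
        - ((a * z' + b) * (c * z + d)) + (a * z + b) * (c * z' + d) by ring.
    rewrite E' mulr0 addr0 valN valM ?pole_num //; lra.
  + have -> : (a * z + b) / (c * z + d) - (a * z' + b) / (c * z' + d) =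
       (z - z') * (a * d - b * c) / ((c * z + d) * (c * z' + d)) by field; rewrite E E'.
    by rewrite valf ?mulf_neq0 // !valM //; lra.
- move=> _; have [E|E] := eqVneq (c * z + d) 0; have [c0|c0] := eqVneq c 0.
  + by rewrite c0 mul0r add0r in E; move: (proj2 (c0_neq c0)); rewrite E eqxx.
  + have -> : a * d - b * c = - (c * (a * z + b)) + a * (c * z + d) by ring.
    by rewrite E mulr0 addr0 valN valM ?pole_num //; lra.
  + rewrite c0 mul0r !add0r mulr0 subr0; have [a0 d0] := c0_neq c0.
    by rewrite valM //; lra.
  + have -> : (a * z + b) / (c * z + d) - a / c = - ((a * d - b * c) / (c * (c * z + d))).
      by field; rewrite E c0.
    by rewrite valN valf ?mulf_neq0 // valM //; lra.
- move=> _; have [E|E] := eqVneq (c * z' + d) 0; have [c0|c0] := eqVneq c 0.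
  + by rewrite c0 mul0r add0r in E; move: (proj2 (c0_neq c0)); rewrite E eqxx.
  + have -> : a * d - b * c = - (c * (a * z' + b)) + a * (c * z' + d) by ring.
    by rewrite E mulr0 addr0 valN valM ?pole_num //; lra.
  + rewrite c0 mul0r !add0r mulr0 subr0; have [a0 d0] := c0_neq c0.
    by rewrite valM //; lra.
  + have -> : a / c - (a * z' + b) / (c * z' + d) = ((a * d - b * c) / (c * (c * z' + d))).
      by field; rewrite E c0.
    by rewrite valf ?mulf_neq0 // valM //; lra.
Qed.

End Moebius.

Lemma moebiusK a b c d : a * d - b * c != 0 ->
  cancel (moebius a b c d) (moebius d (- b) (- c) a).
Proof.
move=> det [z|] /=; last first.
  have [c0|c0] := eqVneq c 0; first by rewrite /= oppr_eq0 c0 eqxx.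
  by rewrite /= mulNr mulrC divfK // addNr eqxx.
have [E|E] := eqVneq (c * z + d) 0.
  rewrite /= oppr_eq0; have [c0|c0] := eqVneq c 0.
    rewrite c0 mul0r add0r in E; move: det; rewrite c0 E !mulr0 subr0 eqxx //.
  congr Some; apply: (mulfI c0); move/eqP: E; rewrite addr_eq0 => /eqP->.
  by rewrite invrN !mulrN mulrCA mulfV // mulr1.
have -> : moebius d (- b) (- c) a (Some ((a * z + b) / (c * z + d))) =
  if (a * d - b * c) / (c * z + d) == 0 then None
  else Some (((a * d - b * c) * z / (c * z + d)) / ((a * d - b * c) / (c * z + d))).
  rewrite /=.
  have -> : - c * ((a * z + b) / (c * z + d)) + a = (a * d - b * c) / (c * z + d) by field.
  have -> : d * ((a * z + b) / (c * z + d)) - b = (a * d - b * c) * z / (c * z + d) by field.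
  by [].
rewrite mulf_eq0 invr_eq0 (negbTE det) (negbTE E) /=.
by congr Some; field; rewrite det E.
Qed.

End Valuation.

(* The branch points of [y^2 = f(x)] on the projective line [option L], [None] being infinity. *)
Definition branch (K L : fieldType) (j : {rmorphism K -> L}) (f : {poly K})
    (P : option L) : bool :=
  if P is Some z then root (map_poly j f) z else ~~ odd (size f).

Lemma separable_roots (L : closedFieldType) (f : {poly L}) : separable_poly f ->
  exists rs, [/\ lead_coef f != 0, uniq rs & f = lead_coef f *: \prod_(r <- rs) ('X - r%:P)].
Proof.
move=> sep; have [rs fE] := closed_field_poly_normal f; exists rs; split=> //.
  by rewrite lead_coef_eq0 separable_poly_neq0.
by move: sep; rewrite fE -mul_polyC separable_mul separable_prod_XsubC => /and3P[].
Qed.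

Lemma card_roots (K : fieldType) (L : closedFieldType) (j : {rmorphism K -> L})
    (f : {poly K}) (T : finType) (rho : T -> L) :
  separable_poly f -> injective rho ->
  (forall z : L, root (map_poly j f) z <-> exists a, rho a = z) ->
  #|T| = (size f).-1.
Proof.
move=> sep rhoI roots.
have [|rs [lc0 urs fE]] := @separable_roots L (map_poly j f); first by rewrite separable_map.
have -> : (size f).-1 = size rs.
  by rewrite -(size_map_poly j) fE size_scale // size_prod_XsubC.
rewrite cardE -(size_map rho); apply/eqP; rewrite -uniq_size_uniq //.
  by rewrite map_inj_uniq ?enum_uniq.
move=> z; rewrite -root_prod_XsubC -(rootZ _ _ lc0) -fE.
apply/idP/mapP => [/roots[a <-]|[a _ ->]]; first by exists a; rewrite ?mem_enum.
by apply/roots; exists a.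
Qed.

Section EvenModel.

Variables (L : fieldType) (v : L -> rat).

(* [t] accounts for the choice of affine coordinates representing the points [pi x]. *)
Definition even_model (B : pred (option L)) (A : cpic) (E : finType)
    (w : E -> E -> rat) (pi : E -> option L) (t : E -> rat) : Prop :=
  [/\ ~~ odd #|E|, (0 < #|E|)%N, ultrametric w, injective pi
    & forall P, B P <-> exists x, pi x = P] /\
  [/\ forall x y, x != y -> w x y = proj_val v (pi x) (pi y) + t x + t y,
      clos_refl_trans cpic cp_step A (pic_of w)
    & clos_refl_trans cpic cp_step (pic_of w) A].

Lemma even_model_equiv (B1 B2 : pred (option L)) (A1 A2 : cpic)
    (E1 E2 : finType) w1 w2 pi1 pi2 t1 t2 (a b c d : L) :
  is_valuation v -> a * d - b * c != 0 ->
  (forall P, B1 P = B2 (moebius a b c d P)) ->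
  @even_model B1 A1 E1 w1 pi1 t1 -> @even_model B2 A2 E2 w2 pi2 t2 ->
  cp_equiv A1 A2.
Proof.
move=> vP det B12 [[ev1 n1 u1 I1 im1] [V1 to1 _]] [[ev2 n2 u2 I2 im2] [V2 _ from2]].
pose M := moebius a b c d; pose M' := moebius d (- b) (- c) a.
have MK : cancel M M' by apply: moebiusK.
have M'K : cancel M' M.
  have := @moebiusK _ d (- b) (- c) a; rewrite /M' /M !opprK; apply.
  by rewrite mulrNN mulrC.
have ex_h x : exists y, pi2 y == M (pi1 x).
  have : B2 (M (pi1 x)) by rewrite -B12; apply/im1; exists x.
  by case/im2 => y E; exists y; apply/eqP.
pose h x := xchoose (ex_h x).
have hE x : pi2 (h x) = M (pi1 x) by apply/eqP/(xchooseP (ex_h x)).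
have ex_g y : exists x, pi1 x == M' (pi2 y).
  have : B1 (M' (pi2 y)) by rewrite B12 -/M M'K; apply/im2; exists y.
  by case/im1 => x E; exists x; apply/eqP.
pose g y := xchoose (ex_g y).
have gE y : pi1 (g y) = M' (pi2 y) by apply/eqP/(xchooseP (ex_g y)).
have hK : cancel h g by move=> x; apply: I1; rewrite gE hE MK.
have gK : cancel g h by move=> y; apply: I2; rewrite hE gE M'K.
have hI := can_inj hK.
pose D := v (a * d - b * c).
pose e x := moebius_weight v a b c d (pi1 x) - D / 2 + t1 x - t2 (h x).
have E x y : x != y -> w2 (h x) (h y) = w1 x y - e x - e y.
  move=> xy; rewrite V2 ?(inj_eq hI) // V1 // !hE proj_val_moebius ?(inj_eq I1) //.
  by rewrite /e /D; lra.
pose w' x y := w2 (h x) (h y).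
have u' : ultrametric w'.
  split=> [x y|x y z xy yz xz]; first exact: (proj1 u2).
  by apply: (proj2 u2); rewrite (inj_eq hI).
left; exists A2; split; last exact: cp_iso_refl.
apply: rt_trans to1 _; apply: rt_trans (reroot ev1 n1 u1 u' E) _.
apply: rt_trans from2; apply: rt_step.
apply: (@pictures_shift_step (pic_of w') (pic_of w2) w' w2 h 0) => //.
- by exists g.
- exact: pic_ofP.
- exact: pic_ofP.
- by move=> x y _; rewrite addr0.
Qed.

End EvenModel.

Lemma exists_even_model (K : fieldType) (L : closedFieldType) (j : {rmorphism K -> L})
    (v : L -> rat) (f : {poly K}) (A : cpic) :
  is_valuation v -> separable_poly f -> (2 < size f)%N -> cluster_picture_of j v f A ->
  exists (E : finType) w pi t, @even_model L v (branch j f) A E w pi t.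
Proof.
move=> vP sep sf [rho [rhoI roots clA dA]].
have cardA := card_roots sep rhoI roots.
pose T := cp_T A; pose w := root_dist v rho.
have uw : ultrametric w by apply: root_dist_ultrametric.
have T1 : (1 < #|T|)%N by rewrite cardA; case: (size f) sf => [|[|[]]].
have odd_f : ~~ odd (size f) = odd #|T|.
  by rewrite cardA; case: (size f) sf => //= n _; rewrite negbK.
have Aw : pictures (A := A) w.
  split=> [s|s Ss s1]; last by have [lo hi] := dA s Ss s1; split.
  by apply/idP/idP => [/clA|] H; [apply/cluster_disc | apply/clA/cluster_disc].
have stepAw : cp_step A (pic_of w).
  apply: (@pictures_shift_step A (pic_of w) w w id 0) => //.
  - by exists id.
  - exact: pic_ofP.
  - by move=> a b _; rewrite addr0.
  - exact: ltnW.
have stepwA : cp_step (pic_of w) A.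
  apply: (@pictures_shift_step (pic_of w) A w w id 0) => //.
  - by exists id.
  - exact: pic_ofP.
  - by move=> a b _; rewrite addr0.
  - exact: ltnW.
have [oT|oT] := boolP (odd #|T|).
  exists (option T), (add_point w), (omap rho), (fun p => if p is None then depth w setT else 0).
  split; split.
  - by rewrite card_option /= oT.
  - by rewrite card_option.
  - exact: add_point_ultrametric.
  - by apply: inj_omap.
  - case=> [z|] /=; last by rewrite odd_f oT; split=> // _; exists None.
    split=> [/roots[a <-]|[[a|] //= [<-]]]; first by exists (Some a).
    by apply/roots; exists a.
  - by case=> [a|] [b|] //= _; rewrite /add_point /proj_val /= ?addr0 ?add0r.
  - by apply: rt_trans (rt_step _ _ _ _ stepAw) _; apply: rt_step; apply: add_root_step.
  - by apply: rt_trans _ (rt_step _ _ _ _ stepwA); apply: rt_step; apply: remove_root_step.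
exists T, w, (fun a => Some (rho a)), (fun=> 0); split; split.
- by [].
- exact: ltnW.
- by [].
- by move=> a b [/rhoI].
- case=> [z|] /=; last by rewrite odd_f (negbTE oT); split=> // -[].
  split=> [/roots[a <-]|[a [<-]]]; first by exists a.
  by apply/roots; exists a.
- by move=> a b _; rewrite !addr0.
- exact: rt_step.
- exact: rt_step.
Qed.

(** * Algebraic relations between two coordinates *)

(* Gauss's lemma: roots of [c] are cancelled one by one, [p] being nonzero at each of them. *)
Lemma gauss_cancel (L : closedFieldType) (c : {poly L}) (p q s : {poly {poly L}}) :
  c != 0 -> c *: q = s * p ->
  (forall h, map_poly (horner_eval h) p != 0) -> exists s', q = s' * p.
Proof.
move=> + + prim; have [n] := ubnP (size c).
elim: n c s => // n IH c s; rewrite ltnS => le_n c0 E.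
have [c1|/closed_rootP[h /factor_theorem[c' cE]]] := eqVneq (size c) 1%N.
  have /size_poly1P[k k0 cE] : size c == 1%N by rewrite c1.
  exists (k^-1%:P *: s); rewrite -scalerAl -E cE scalerA -polyCM mulVf //.
  by rewrite scale1r.
have X0 : 'X - h%:P != 0 :> {poly L} by rewrite polyXsubC_eq0.
have c'0 : c' != 0 by apply: contraNneq c0 => c'0; rewrite cE c'0 mul0r.
have s0 : map_poly (horner_eval h) s = 0.
  have := congr1 (map_poly (horner_eval h)) E.
  rewrite -mul_polyC !rmorphM /= map_polyC /= [horner_eval h c]/horner_eval cE hornerM.
  rewrite hornerXsubC subrr mulr0 mul0r => /esym/eqP.
  by rewrite mulf_eq0 (negbTE (prim h)) orbF => /eqP.
pose s' : {poly {poly L}} := \poly_(k < size s) (s`_k %/ ('X - h%:P)).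
have sE : s = ('X - h%:P) *: s'.
  apply/polyP => k; rewrite coefZ coef_poly; case: ltnP => ks; last first.
    by rewrite mulr0 nth_default.
  rewrite mulrC divpK // dvdp_XsubCl /root.
  by have := congr1 (fun r : {poly L} => r`_k) s0; rewrite coef_map coef0 /= /horner_eval => ->.
apply: (IH c' s') => //.
  by apply: leq_trans le_n; rewrite cE size_Mmonic ?monicXsubC // size_XsubC addn2.
apply/eqP; rewrite -subr_eq0 -(inj_eq (@mulfI _ ('X - h%:P)%:P _)) ?polyC_eq0 //.
rewrite mulr0 mulrBr mulrA !mul_polyC -sE -E scalerA [_ * c']mulrC -cE.
by rewrite subrr.
Qed.

Section BidegreeRelations.

Variables (K F : fieldType) (i : {rmorphism K -> F}).

Definition transcendental (x : F) := forall p : {poly K}, p != 0 -> (map_poly i p).[x] != 0.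

Variables x1 x2 : F.

(* [p] is a polynomial in [X] with coefficients in [K[H]], evaluated at [X = x1], [H = x2]. *)
Definition eval2 (p : {poly {poly K}}) : F := (map_poly (map_poly i) p).[x1%:P].[x2].

Lemma eval2M p q : eval2 (p * q) = eval2 p * eval2 q.
Proof. by rewrite /eval2 rmorphM !hornerM. Qed.

Lemma eval2D p q : eval2 (p + q) = eval2 p + eval2 q.
Proof. by rewrite /eval2 rmorphD !hornerD. Qed.

Lemma eval2C p : eval2 p%:P = (map_poly i p).[x2].
Proof. by rewrite /eval2 map_polyC hornerC. Qed.

Lemma eval2X : eval2 'X = x1.
Proof. by rewrite /eval2 map_polyX hornerX hornerC. Qed.

Lemma eval2Z c p : eval2 (c *: p) = (map_poly i c).[x2] * eval2 p.
Proof. by rewrite -mul_polyC eval2M eval2C. Qed.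

Definition relation (p : {poly {poly K}}) := p != 0 /\ eval2 p = 0.

Variables (L : closedFieldType) (j : {rmorphism K -> L}).
Hypothesis tr2 : transcendental x2.

Let primitive_of_minimal (p : {poly {poly K}}) : relation p ->
  (forall q, relation q -> (size q <= size p)%N -> (sizeY p <= sizeY q)%N) ->
  forall h, map_poly (horner_eval h) (map_poly (map_poly j) p) != 0.
Proof.
move=> [p0 pe] pmin h; apply/eqP => ph.
have rooth k : root (map_poly j p`_k) h.
  have := congr1 (fun r : {poly L} => r`_k) ph.
  by rewrite !coef_map coef0 /= /horner_eval => /rootP.
pose g : {poly K} := \big[@gcdp K/0]_(r <- p : seq {poly K}) r.
have rootg : root (map_poly j g) h.
  have -> : map_poly j g = \big[@gcdp L/0]_(r <- [seq map_poly j r | r <- p : seq {poly K}]) r.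
    rewrite big_map /g; apply: (big_morph (map_poly j)); last exact: rmorph0.
    by move=> a b; rewrite gcdp_map.
  rewrite root_biggcd all_map; apply/allP => r /(nthP 0)[k _ <-]; exact: rooth.
have gdvd k : g %| p`_k.
  have [kp|kp] := ltnP k (size p); last by rewrite nth_default // dvdp0.
  have : p`_k \in (p : seq {poly K}) by apply: mem_nth.
  rewrite /g; move: (p`_k) => r0; elim: (p : seq {poly K}) => // r rs IH; rewrite inE big_cons.
  case/orP => [/eqP->|/IH]; first exact: dvdp_gcdl.
  by apply: dvdp_trans; apply: dvdp_gcdr.
have g0 : g != 0.
  apply: contraNneq p0 => g0; apply/eqP/polyP => k.
  by have := gdvd k; rewrite g0 dvd0p coef0 => /eqP.
pose q : {poly {poly K}} := \poly_(k < size p) (p`_k %/ g).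
have pE : p = g *: q.
  apply/polyP => k; rewrite coefZ coef_poly; case: ltnP => kp; last first.
    by rewrite mulr0 nth_default.
  by rewrite mulrC divpK.
have q0 : q != 0 by apply: contraNneq p0 => q0; rewrite pE q0 scaler0.
have qrel : relation q.
  split=> //; apply/eqP; move/eqP: pe; rewrite pE eval2Z mulf_eq0.
  by rewrite (negbTE (tr2 g0)).
have := pmin q qrel; rewrite pE size_scale // leqnn => /(_ isT).
rewrite !sizeYE -mul_polyC rmorphM /= swapXY_polyC size_mul ?map_polyC_eq0 ?swapXY_eq0 //.
rewrite size_map_polyC -[X in (_ <= X)%N]add0n.
have : (1 < size g)%N.
  by rewrite -(size_map_poly j); apply: root_size_gt1 rootg; rewrite map_poly_eq0.
by case: (size g) => [|[|n]] //= _; rewrite leqNgt !addSn /= ltnS leq_addl.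
Qed.

Lemma bidegree_relation m n :
  (exists p, relation p /\ (size p <= m)%N) -> (exists p, relation p /\ (sizeY p <= n)%N) ->
  exists p, [/\ relation p, (size p <= m)%N & (sizeY p <= n)%N].
Proof.
move=> [p0 [p0rel p0m]] [q [[q0 qe] qn]].
have ex1 : exists k, `[< exists p, relation p /\ size p = k >].
  by exists (size p0); apply/asboolP; exists p0.
case: (ex_minnP ex1) => k /asboolP[p1 [p1rel p1k]] kmin.
have ex2 : exists l, `[< exists p, [/\ relation p, size p = k & sizeY p = l] >].
  by exists (sizeY p1); apply/asboolP; exists p1.
case: (ex_minnP ex2) => l /asboolP[p [prel pk pl]] lmin.
have size_min r : relation r -> (size p <= size r)%N.
  by move=> rrel; rewrite pk; apply: kmin; apply/asboolP; exists r.
have prim : forall h, map_poly (horner_eval h) (map_poly (map_poly j) p) != 0.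
  apply: primitive_of_minimal => // r rrel rp; rewrite pl; apply: lmin.
  by apply/asboolP; exists r; split=> //; apply/eqP; rewrite -pk eqn_leq rp size_min.
exists p; split=> //; first by apply: leq_trans p0m; apply: size_min.
have [pn0 pe] := prel.
have divE := Pdiv.Idomain.divp_eq q p.
have rem0 : q %% p = 0.
  apply/eqP; apply/negPn/negP => r0.
  have : relation (q %% p).
    split=> //; have := congr1 eval2 divE.
    by rewrite eval2Z eval2D eval2M qe pe !mulr0 add0r => <-.
  by move/size_min; rewrite leqNgt Pdiv.Idomain.ltn_modp pn0.
pose c := lead_coef p ^+ scalp q p.
have c0 : c != 0 by rewrite expf_neq0 // lead_coef_eq0.
have inj_j : injective (map_poly j) by apply: map_inj_poly; [apply: fmorph_inj | rewrite rmorph0].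
have jp0 (r : {poly {poly K}}) : r != 0 -> map_poly (map_poly j) r != 0.
  by move=> r0; rewrite -size_poly_eq0 size_map_inj_poly ?rmorph0 // size_poly_eq0.
have sizeYj (r : {poly {poly K}}) : sizeY (map_poly (map_poly j) r) = sizeY r.
  by rewrite !sizeYE swapXY_map size_map_inj_poly ?rmorph0.
have [||s' sE] := @gauss_cancel L (map_poly j c) (map_poly (map_poly j) p)
   (map_poly (map_poly j) q) (map_poly (map_poly j) (q %/ p)) _ _ prim.
- by rewrite map_poly_eq0.
- by rewrite -mul_polyC -map_polyC -!rmorphM /= mul_polyC divE rem0 addr0.
apply: leq_trans qn; rewrite -(sizeYj q) -(sizeYj p) sE !sizeYE rmorphM /=.
have s'0 : s' != 0.
  by apply: contraNneq (jp0 q q0) => s'0; rewrite sE s'0 mul0r.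
rewrite size_mul ?swapXY_eq0 ?jp0 //.
have : (0 < size (swapXY s'))%N by rewrite size_poly_gt0 swapXY_eq0.
by case: (size (swapXY s')) => //= k' _; rewrite leq_addl.
Qed.

End BidegreeRelations.

(** * Function fields of hyperelliptic curves *)

Definition horner_simp :=
  (horner0, hornerD, hornerN, hornerM, hornerZ, horner_exp, hornerX, hornerC).

Lemma mup_separable_roots (L : closedFieldType) (f : {poly L}) (z : L) :
  separable_poly f -> mup z f = root f z :> nat.
Proof.
case/separable_roots => rs [lc0 urs fE].
rewrite fE rootZ // root_prod_XsubC -mul_polyC mupMr ?rootC // mu_prod_XsubC.
exact: count_uniq_mem.
Qed.

Lemma odd_mup_square_multiple (F : fieldType) (p q u w : {poly F}) (z : F) :
  p != 0 -> q != 0 -> u != 0 -> p * u ^+ 2 = w ^+ 2 * q ->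
  odd (mup z p) = odd (mup z q).
Proof.
move=> p0 q0 u0 E.
have w0 : w != 0.
  apply/eqP => w0; move/eqP: E; rewrite w0 expr0n mul0r mulf_eq0 (negbTE p0) expf_eq0.
  by rewrite (negbTE u0).
have := congr1 (fun r => odd (mup z r)) E.
by rewrite !mupM ?mulf_neq0 // !oddD !addbb addbF.
Qed.

Lemma separable_square_multiple_size (K : fieldType) (L : closedFieldType)
    (j : {rmorphism K -> L}) (f p u w : {poly K}) :
  separable_poly f -> p != 0 -> u != 0 -> p * u ^+ 2 = w ^+ 2 * f ->
  (size f <= size p)%N.
Proof.
move=> sep p0 u0 E.
have f0 := separable_poly_neq0 sep.
have sepj : separable_poly (map_poly j f) by rewrite separable_map.
have Ej : map_poly j p * map_poly j u ^+ 2 = map_poly j w ^+ 2 * map_poly j f.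
  by rewrite -!rmorphXn -!rmorphM E.
have [rs [lc0 urs fE]] := separable_roots sepj.
rewrite -(size_map_poly j f) -(size_map_poly j p) fE size_scale // size_prod_XsubC.
apply: max_poly_roots => //; first by rewrite map_poly_eq0.
apply/allP => z zrs.
have fz : root (map_poly j f) z by rewrite fE rootZ // root_prod_XsubC.
have := odd_mup_square_multiple z _ _ _ Ej; rewrite !map_poly_eq0 p0 f0 u0.
move=> /(_ isT isT isT); rewrite (mup_separable_roots z sepj) fz /=.
by apply: contraTT => pz; rewrite mupNroot.
Qed.

Section RationalFunctions.

Variables (K F : fieldType) (i : {rmorphism K -> F}) (x : F).

Local Notation ev p := (map_poly i p).[x].

Definition rational_in (z : F) := exists a c : {poly K}, ev c != 0 /\ z = ev a / ev c.

Lemma rational_poly p : rational_in (ev p).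
Proof. by exists p, 1; rewrite rmorph1 hornerC divr1 oner_neq0. Qed.

Lemma rational_const k : rational_in (i k).
Proof. by have := rational_poly k%:P; rewrite map_polyC hornerC. Qed.

Lemma rational_add z z' : rational_in z -> rational_in z' -> rational_in (z + z').
Proof.
move=> [a [c [c0 ->]]] [a' [c' [c0' ->]]]; exists (a * c' + a' * c), (c * c').
by rewrite rmorphD !rmorphM /= !horner_simp mulf_neq0 //; split=> //; field; rewrite c0 c0'.
Qed.

Lemma rational_mul z z' : rational_in z -> rational_in z' -> rational_in (z * z').
Proof.
move=> [a [c [c0 ->]]] [a' [c' [c0' ->]]]; exists (a * a'), (c * c').
by rewrite !rmorphM /= !horner_simp mulf_neq0 //; split=> //; field; rewrite c0 c0'.
Qed.

Lemma rational_inv z : rational_in z -> rational_in z^-1.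
Proof.
move=> [a [c [c0 ->]]]; have [a0|a0] := eqVneq (ev a) 0.
  by rewrite a0 mul0r invr0 -(rmorph0 i); apply: rational_const.
by exists c, a; rewrite invf_div.
Qed.

Lemma rational_opp z : rational_in z -> rational_in (- z).
Proof.
by move=> rz; rewrite -mulN1r -(rmorphN1 i); apply: rational_mul => //; apply: rational_const.
Qed.

Lemma rational_div z z' : rational_in z -> rational_in z' -> rational_in (z / z').
Proof. by move=> rz rz'; apply: rational_mul => //; apply: rational_inv. Qed.

Lemma rational_horner p z : rational_in z -> rational_in (map_poly i p).[z].
Proof.
move=> rz; elim/poly_ind: p => [|p k IH].
  by rewrite rmorph0 horner0 -(rmorph0 i); apply: rational_const.
rewrite rmorphD rmorphM /= map_polyX map_polyC /= !horner_simp.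
by apply: rational_add; [apply: rational_mul | apply: rational_const].
Qed.

End RationalFunctions.

Lemma rational_trans (K F : fieldType) (i : {rmorphism K -> F}) (x y z : F) :
  rational_in i x y -> rational_in i y z -> rational_in i x z.
Proof.
by move=> xy [a [c [_ ->]]]; apply: rational_div; apply: rational_horner.
Qed.

Section QuadraticFunctionField.

Variables (K F : fieldType) (i : {rmorphism K -> F}) (f : {poly K}) (x y : F).
Hypothesis Fxy : is_function_field i f x y.
Hypothesis two0 : (2%:R : K) != 0.

Local Notation ev p := (map_poly i p).[x].

Lemma function_field_transcendental : transcendental i x.
Proof. by case: Fxy. Qed.

Let tr := function_field_transcendental.

Lemma ev_inj p q : ev p = ev q -> p = q.
Proof.
move=> E; apply/eqP; rewrite -subr_eq0; apply/negPn/negP => /tr.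
by rewrite rmorphB hornerD hornerN E subrr eqxx.
Qed.

Let ev0 : ev 0 = 0. Proof. by rewrite rmorph0 horner0. Qed.
Let ev1 : ev 1 = 1. Proof. by rewrite rmorph1 hornerC. Qed.

Definition quadratic_form (z : F) := exists a b c : {poly K},
  ev c != 0 /\ z = (ev a + ev b * y) / ev c.

Lemma function_field_quadratic z : quadratic_form z.
Proof.
have y2 : y ^+ 2 = ev f by case: Fxy.
have [_ _ gen] := Fxy.
pose S : {pred F} := fun z => `[< quadratic_form z >].
suff /asboolP : z \in S by [].
apply: gen => [k|||||].
- apply/asboolP; exists k%:P, 0, 1; rewrite ev1 ev0 map_polyC hornerC.
  by rewrite oner_neq0 mul0r addr0 divr1.
- apply/asboolP; exists 'X, 0, 1; rewrite ev1 ev0 map_polyX hornerX.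
  by rewrite oner_neq0 mul0r addr0 divr1.
- apply/asboolP; exists 0, 1, 1; rewrite ev1 ev0.
  by rewrite oner_neq0 mul1r add0r divr1.
- move=> u u' /asboolP[a [b [c [c0 ->]]]] /asboolP[a' [b' [c' [c0' ->]]]].
  apply/asboolP; exists (a * c' - a' * c), (b * c' - b' * c), (c * c').
  rewrite !(rmorphB, rmorphM) /= !horner_simp mulf_neq0 //; split=> //.
  by field; rewrite c0 c0'.
- move=> u u' /asboolP[a [b [c [c0 ->]]]] /asboolP[a' [b' [c' [c0' ->]]]].
  apply/asboolP; exists (a * a' + b * b' * f), (a * b' + a' * b), (c * c').
  rewrite !(rmorphD, rmorphM) /= !horner_simp -y2 mulf_neq0 //; split=> //.
  by field; rewrite c0 c0'.
move=> u /asboolP[a [b [c [c0 ->]]]]; apply/asboolP.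
have [n0|n0] := eqVneq (ev a + ev b * y) 0.
  exists 0, 0, 1; rewrite n0 mul0r invr0 ev0 ev1 oner_neq0.
  by rewrite mul0r addr0 mul0r.
have normE : ev (a ^+ 2 - b ^+ 2 * f) = (ev a + ev b * y) * (ev a - ev b * y).
  by rewrite !expr2 rmorphB !rmorphM /= !horner_simp -y2; ring.
have [c'0|c'0] := eqVneq (ev a - ev b * y) 0.
  have aE : ev a + ev b * y = 2%:R * ev a.
    by move/eqP: c'0; rewrite subr_eq0 => /eqP <-; ring.
  exists c, 0, (2%:R *: a); rewrite map_polyZ /= rmorph_nat hornerZ -aE; split=> //.
  by rewrite rmorph0 horner0 mul0r addr0 invf_div.
exists (c * a), (- (c * b)), (a ^+ 2 - b ^+ 2 * f); rewrite normE mulf_neq0 //; split=> //.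
by rewrite rmorphN !rmorphM /= !horner_simp; field; rewrite n0 c0 c'0.
Qed.

Variables (L : closedFieldType) (j : {rmorphism K -> L}).
Hypotheses (sep : separable_poly f) (size_f : (5 < size f)%N).

Lemma y_not_rational : ~ rational_in i x y.
Proof.
move=> [a [c [c0 yE]]].
have y2 : y ^+ 2 = ev f by case: Fxy.
have E : a ^+ 2 = c ^+ 2 * f.
  apply: ev_inj; rewrite !expr2 !rmorphM /= !horner_simp -y2 yE; field.
  by rewrite c0.
have c0' : c != 0 by apply: contraNneq c0 => ->; rewrite rmorph0 horner0.
have a0 : a != 0.
  apply: contraNneq c0' => a0; move/eqP: E; rewrite a0 expr0n eq_sym mulf_eq0 expf_eq0 /=.
  by rewrite (negbTE (separable_poly_neq0 sep)) orbF.
rewrite -[a ^+ 2]mul1r in E.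
have := separable_square_multiple_size j sep (oner_neq0 _) a0 E.
by rewrite size_poly1 leqNgt (ltn_trans _ size_f).
Qed.

Lemma quadratic_rational a b z : rational_in i x z ->
  ev a + ev b * y = z -> b = 0.
Proof.
move=> rz E; apply/eqP; apply/negPn/negP => /tr b0.
apply: y_not_rational; have -> : y = (z - ev a) / ev b by rewrite -E; field.
apply: rational_div; last exact: rational_poly.
by apply: rational_add => //; apply: rational_opp; apply: rational_poly.
Qed.

Lemma square_rational a b z : rational_in i x z ->
  (ev a + ev b * y) ^+ 2 = z -> a = 0 \/ b = 0.
Proof.
have y2 : y ^+ 2 = ev f by case: Fxy.
move=> rz E; have : 2%:R *: (a * b) = 0.
  apply: (@quadratic_rational (a ^+ 2 + b ^+ 2 * f) _ z rz).
  rewrite -E map_polyZ /= rmorph_nat !expr2 rmorphD !rmorphM /= !horner_simp -y2.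
  by ring.
move/eqP; rewrite scaler_eq0 (negbTE two0) mulf_eq0 /= => /orP[] /eqP; by [left|right].
Qed.

End QuadraticFunctionField.

Lemma size_linear_bivariate (K : fieldType) (a c : {poly K}) : c != 0 ->
  size (c%:P * 'X - a%:P : {poly {poly K}}) = 2%N.
Proof. by move=> c0; rewrite -polyCN size_MXaddC polyC_eq0 (negbTE c0) size_polyC c0. Qed.

Lemma relation_swap (K F : fieldType) (i : {rmorphism K -> F}) (x1 x2 : F) (p : {poly {poly K}}) :
  relation i x1 x2 p -> relation i x2 x1 (swapXY p).
Proof.
case=> p0 pe; split; first by rewrite swapXY_eq0.
by rewrite /eval2 -swapXY_map horner2_swapXY.
Qed.

Lemma sizeY_swapXY (R : nzRingType) (p : {poly {poly R}}) : sizeY (swapXY p) = size p.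
Proof. by rewrite sizeYE swapXYK. Qed.

Lemma eval2_coef (K F : fieldType) (i : {rmorphism K -> F}) (x1 x2 : F) n (p : {poly {poly K}}) :
  (size p <= n)%N ->
  eval2 i x1 x2 p = \sum_(k < n) (map_poly i p`_k).[x2] * x1 ^+ k.
Proof.
move=> pn; rewrite -[p in LHS]coefK (@poly_def _ (size p)).
rewrite (big_ord_widen_cond n xpredT (fun k => p`_k *: 'X^k)) //.
rewrite big_mkcond /= /eval2 rmorph_sum /= !horner_sum; apply: eq_bigr => k _.
have [kp|kp] := ltnP k (size p).
  by rewrite -mul_polyC !rmorphM /= map_polyC map_polyXn !(hornerM, hornerC, hornerXn, horner_exp).
by rewrite nth_default // !rmorph0 !horner0 mul0r.
Qed.

Lemma exists_quadratic_relation (K F : fieldType) (i : {rmorphism K -> F}) (f : {poly K})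
    (x y z : F) : is_function_field i f x y ->
  exists p, relation i z x p /\ (size p <= 3)%N.
Proof.
move=> Fxy; have [a [b [c [c0 zE]]]] := function_field_quadratic Fxy z.
have y2 : y ^+ 2 = (map_poly i f).[x] by case: Fxy.
have c0' : c != 0 by apply: contraNneq c0 => ->; rewrite rmorph0 horner0.
pose q : {poly {poly K}} := c%:P * 'X - a%:P.
have sq : size q = 2%N by apply: size_linear_bivariate.
have q0 : q != 0 by rewrite -size_poly_eq0 sq.
have sqq : size (q ^+ 2) = 3%N by rewrite expr2 size_mul // sq.
have sp : size (q ^+ 2 - (b ^+ 2 * f)%:P) = 3%N.
  by rewrite size_polyDl sqq // size_polyN (leq_ltn_trans (size_polyC_leq1 _)).
exists (q ^+ 2 - (b ^+ 2 * f)%:P); split; last by rewrite sp.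
split; first by rewrite -size_poly_eq0 sp.
have -> : q ^+ 2 - (b ^+ 2 * f)%:P = q * q + (- (b ^+ 2 * f))%:P by rewrite polyCN expr2.
have qE : eval2 i z x q = (map_poly i b).[x] * y.
  rewrite /q -polyCN eval2D eval2M !eval2C eval2X zE rmorphN hornerN.
  by field.
rewrite eval2D eval2M eval2C qE rmorphN expr2 !rmorphM /= !(hornerN, hornerM) -y2.
by ring.
Qed.

Section TwoModels.

Variables (K F : fieldType) (L : closedFieldType) (i : {rmorphism K -> F}) (j : {rmorphism K -> L}).
Hypothesis two0 : (2%:R : K) != 0.

Lemma abscissa_rational (f1 f2 : {poly K}) (x1 y1 x2 y2 : F) :
  is_function_field i f1 x1 y1 -> is_function_field i f2 x2 y2 ->
  separable_poly f1 -> (5 < size f1)%N -> rational_in i x1 x2.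
Proof.
move=> F1 F2 sep1 size1.
have tr1 := function_field_transcendental F1.
have [p [[p0 pe] px pY]] : exists p, [/\ relation i x2 x1 p, (size p <= 3)%N & (sizeY p <= 3)%N].
  apply: (bidegree_relation j tr1).
    exact: (exists_quadratic_relation x2 F1).
  have [q [qrel q3]] := exists_quadratic_relation x1 F2.
  by exists (swapXY q); rewrite sizeY_swapXY; split=> //; apply: relation_swap.
have ps k : (size (p`_k)%R <= 3)%N by apply: leq_trans (max_size_coefXY _ _) pY.
move: pe; rewrite (eval2_coef i x2 x1 px) !big_ord_recl big_ord0 /= /bump /= !add1n.
rewrite expr0 mulr1 expr1 addr0.
set P := p`_2; set Q := p`_1; set R := p`_0 => pe.
pose ev (q : {poly K}) := (map_poly i q).[x1].
rewrite -/(ev P) -/(ev Q) -/(ev R) in pe.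
have [P0|P0] := eqVneq P 0.
  have [Q0|Q0] := eqVneq Q 0.
    have R0 : R = 0.
      apply/eqP/negPn/negP => /tr1; rewrite -/(ev R).
      by move: pe; rewrite P0 Q0 /ev rmorph0 horner0 !mul0r !addr0 => ->; rewrite eqxx.
    case/eqP: p0; apply/polyP => k; rewrite coef0; have [k3|k3] := ltnP k 3.
      by case: k k3 => [|[|[|]]].
    by rewrite nth_default // (leq_trans px).
  exists (- R), Q; split; first exact: tr1.
  apply: (mulfI (tr1 _ Q0)); rewrite rmorphN hornerN mulrCA mulfV ?tr1 // mulr1.
  move: pe; rewrite P0 /ev rmorph0 horner0 mul0r addr0 => /eqP.
  by rewrite addrC addr_eq0 => /eqP.
have [a [b [c [c0 x2E]]]] := function_field_quadratic F1 x2.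
rewrite -/(ev a) -/(ev b) -/(ev c) in c0 x2E.
have [b0|b0] := eqVneq b 0.
  by exists a, c; split=> //; rewrite x2E b0 /ev rmorph0 horner0 mul0r addr0.
pose D := Q ^+ 2 - 4%:R *: (P * R).
pose al := 2%:R *: (P * a) + Q * c; pose be := 2%:R *: (P * b).
have sq : (ev al + ev be * y1) ^+ 2 = ev (c ^+ 2 * D).
  have -> : ev al + ev be * y1 = ev c * (2%:R * ev P * x2 + ev Q).
    rewrite /ev /al /be rmorphD !rmorphM /= !map_polyZ /= !rmorphM !rmorph_nat /=.
    rewrite !horner_simp -!/(ev _) x2E.
    by field.
  rewrite /D /ev !expr2 rmorphM rmorphB !rmorphM /= map_polyZ /= rmorphM rmorph_nat /=.
  rewrite !horner_simp.
  rewrite -!/(ev _); have -> : ev R = - (ev Q * x2 + ev P * x2 ^+ 2).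
    by apply/eqP; rewrite -addr_eq0 pe.
  by ring.
have be0 : be != 0 by rewrite scaler_eq0 (negbTE two0) mulf_neq0.
have [al0|/eqP] := square_rational F1 two0 j sep1 size1 (rational_poly i x1 _) sq; last first.
  by rewrite (negbTE be0).
have DE : D * c ^+ 2 = be ^+ 2 * f1.
  apply: (ev_inj F1); have y2' : y1 ^+ 2 = ev f1 by case: F1.
  rewrite mulrC -/(ev _) -sq al0 /ev rmorph0 horner0 add0r exprMn y2'.
  by rewrite rmorphM hornerM expr2 [in RHS]expr2 rmorphM hornerM.
have c0' : c != 0 by apply: contraNneq c0 => ->; rewrite /ev rmorph0 horner0.
have D0 : D != 0.
  apply: contraTneq be0 => D0; move/eqP: DE; rewrite D0 mul0r eq_sym mulf_eq0 expf_eq0 /=.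
  by rewrite (negbTE (separable_poly_neq0 sep1)) orbF => ->.
have := separable_square_multiple_size j sep1 D0 c0' DE.
have size_mul5 (u w : {poly K}) : (size u <= 3)%N -> (size w <= 3)%N -> (size (u * w)%R <= 5)%N.
  move=> u3 w3; apply: leq_trans (size_polyMleq _ _) _.
  by rewrite -subn1 leq_subLR; apply: (leq_add u3 w3).
have [P3 Q3 R3] : [/\ (size P <= 3)%N, (size Q <= 3)%N & (size R <= 3)%N] by split; apply: ps.
have D5 : (size D <= 5)%N.
  apply: leq_trans (size_polyD _ _) _; rewrite geq_max size_polyN expr2.
  by rewrite size_mul5 //=; apply: leq_trans (size_scale_leq _ _) _; apply: size_mul5.
by rewrite leqNgt (leq_ltn_trans D5 size1).
Qed.

Lemma exists_moebius_relation (x1 x2 : F) : transcendental i x1 -> transcendental i x2 ->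
  rational_in i x1 x2 -> rational_in i x2 x1 ->
  exists a b c d : K, a * d - b * c != 0 /\ (i c * x1 + i d) * x2 = i a * x1 + i b.
Proof.
move=> tr1 tr2 r12 r21.
have rel x x' : rational_in i x x' -> exists p, relation i x' x p /\ (size p <= 2)%N.
  move=> [a [c [c0 E]]].
  have c0' : c != 0 by apply: contraNneq c0 => ->; rewrite rmorph0 horner0.
  have s2 := size_linear_bivariate a c0'.
  exists (c%:P * 'X - a%:P); split; last by rewrite s2.
  split; first by rewrite -size_poly_eq0 s2.
  rewrite -polyCN eval2D eval2M !eval2C eval2X rmorphN hornerN E.
  by rewrite mulrC divfK // subrr.
have [p [[p0 pe] px pY]] : exists p, [/\ relation i x2 x1 p, (size p <= 2)%N & (sizeY p <= 2)%N].
  apply: (bidegree_relation j tr1); first exact: rel.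
  have [q [qrel q2]] := rel _ _ r21.
  by exists (swapXY q); rewrite sizeY_swapXY; split=> //; apply: relation_swap.
have ps k : (size (p`_k)%R <= 2)%N by apply: leq_trans (max_size_coefXY _ _) pY.
have lin (q : {poly K}) x : (size q <= 2)%N -> (map_poly i q).[x] = i q`_1 * x + i q`_0.
  move=> q2; rewrite (@horner_coef_wide _ 2) ?size_map_poly // !big_ord_recl big_ord0 /=.
  by rewrite !coef_map /bump /= expr0 mulr1 expr1 addr0 addrC.
move: pe; rewrite (eval2_coef i x2 x1 px) !big_ord_recl big_ord0 /= /bump /= !add1n.
rewrite expr0 mulr1 expr1 addr0 !lin //.
set g := p`_1`_1; set d := p`_1`_0; set a := p`_0`_1; set b := p`_0`_0 => E.
have E' : (i g * x1 + i d) * x2 = i (- a) * x1 + i (- b).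
  rewrite !rmorphN mulNr -opprD; apply/eqP; rewrite -addr_eq0 addrC; exact/eqP.
exists (- a), (- b), g, d; split=> //.
have lin0 u w : i u * x1 + i w = 0 -> u = 0 /\ w = 0.
  move=> uw0; pose q := u%:P * 'X + w%:P.
  have q0 : q = 0.
    apply/eqP/negPn/negP => /tr1; rewrite /q rmorphD rmorphM /= !map_polyC map_polyX.
    by rewrite !horner_simp uw0 eqxx.
  have := congr1 (fun r : {poly K} => (r`_1, r`_0)) q0.
  by rewrite /q !coefD !coefMX !coefC /= addr0 add0r => -[-> ->].
have gd_neq0 : g = 0 -> d = 0 -> False.
  move=> g0 d0.
  have [a0 b0] : - a = 0 /\ - b = 0 by apply: lin0; rewrite -E' g0 d0 rmorph0 mul0r addr0 mul0r.
  case/eqP: p0; apply/polyP => k; rewrite coef0; have [k2|k2] := ltnP k 2; last first.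
    by rewrite nth_default // (leq_trans px).
  apply/polyP => l; rewrite coef0; have [l2|l2] := ltnP l 2; last first.
    by rewrite nth_default // (leq_trans (ps _)).
  move/eqP: a0; move/eqP: b0; rewrite !oppr_eq0 => /eqP b0 /eqP a0.
  by case: k k2 => [|[|]] // _; case: l l2 => [|[|]].
apply/eqP => det0.
have [k [aE bE]] : exists k, - a = k * g /\ - b = k * d.
  have [g0|g0] := eqVneq g 0; last first.
    exists (- a / g); rewrite divfK //; split=> //.
    apply: (mulIf g0); rewrite mulrAC divfK //; apply/eqP.
    by rewrite -subr_eq0 -oppr_eq0 opprB det0.
  have [d0|d0] := eqVneq d 0; last first.
    exists (- b / d); rewrite divfK // g0 mulr0; split=> //.
    by move/eqP: det0; rewrite g0 mulr0 subr0 mulf_eq0 (negbTE d0) orbF => /eqP.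
  by case: (gd_neq0 g0 d0).
have [gd0|gd0] := eqVneq (i g * x1 + i d) 0.
  by have [g0 d0] := lin0 _ _ gd0; case: (gd_neq0 g0 d0).
have x2k : x2 = i k.
  by apply: (mulfI gd0); rewrite E' aE bE !rmorphM; ring.
have /tr2 : ('X - k%:P : {poly K}) != 0 by rewrite polyXsubC_eq0.
by rewrite rmorphB /= map_polyX map_polyC hornerXsubC x2k subrr eqxx.
Qed.

End TwoModels.

Section Homogenisation.

Variable R : fieldType.
Implicit Types (n l p : {poly R}) (s : seq R).

(* This is [l ^ N * p (n / l)] for [N] at least the degree of [p]. *)
Definition homogenised N n l p := \sum_(k < N.+1) p`_k *: (n ^+ k * l ^+ (N - k)).

Lemma homogenised_mulXsubC N n l p r : (size p <= N.+1)%N ->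
  homogenised N.+1 n l (p * ('X - r%:P)) = (n - r *: l) * homogenised N n l p.
Proof.
move=> sp; rewrite mulrBl /homogenised.
have -> : \sum_(k < N.+2) (p * ('X - r%:P))`_k *: (n ^+ k * l ^+ (N.+1 - k)) =
    \sum_(k < N.+2) (p * 'X)`_k *: (n ^+ k * l ^+ (N.+1 - k)) -
    \sum_(k < N.+2) r *: (p`_k *: (n ^+ k * l ^+ (N.+1 - k))).
  rewrite -sumrB; apply: eq_bigr => k _.
  by rewrite mulrBr coefB coefMC scalerBl scalerA [p`_k * r]mulrC.
congr (_ - _).
  rewrite big_ord_recl coefMX /= scale0r add0r big_distrr /=; apply: eq_bigr => k _.
  by rewrite coefMX /bump /= add1n subSS -scalerAr mulrA exprS.
rewrite big_ord_recr /= [p`_N.+1]nth_default // scale0r scaler0 addr0 -scalerAl big_distrr /=.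
rewrite scaler_sumr; apply: eq_bigr => k _.
have kN : (k <= N)%N by rewrite -ltnS.
by rewrite (subSn kN) exprS -!scalerAr mulrCA.
Qed.

Lemma homogenised_prod n l s e :
  homogenised (size s + e) n l (\prod_(r <- s) ('X - r%:P)) =
  \prod_(r <- s) (n - r *: l) * l ^+ e.
Proof.
elim: s => [|r s IH].
  rewrite !big_nil mul1r /homogenised big_ord_recl coef1 expr0 mul1r subn0 scale1r.
  by rewrite big1 ?addr0 // => k _; rewrite coef1 scale0r.
rewrite !big_cons addSn mulrC homogenised_mulXsubC ?IH ?mulrA //.
by rewrite size_prod_XsubC ltnS leq_addr.
Qed.

Lemma homogenisedZ N n l c p : homogenised N n l (c *: p) = c *: homogenised N n l p.
Proof.
by rewrite /homogenised scaler_sumr; apply: eq_bigr => k _; rewrite coefZ scalerA.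
Qed.

Lemma mup_linear (q : {poly R}) (z : R) : q != 0 -> (size q <= 2)%N -> mup z q = root q z :> nat.
Proof.
move=> q0 q2; have [rqz|] := boolP (root q z); last exact: mupNroot.
apply/eqP; rewrite eqn_leq -XsubC_dvd // dvdp_XsubCl rqz andbT mup_leq //.
by apply/negP => /(dvdp_leq q0); rewrite size_exp_XsubC leqNgt ltnS q2.
Qed.

End Homogenisation.

Lemma map_homogenised (K F : fieldType) (i : {rmorphism K -> F}) N (n l p : {poly K}) :
  map_poly i (homogenised N n l p) =
  homogenised N (map_poly i n) (map_poly i l) (map_poly i p).
Proof.
rewrite /homogenised rmorph_sum; apply: eq_bigr => k _ /=.
by rewrite map_polyZ coef_map rmorphM !rmorphXn.
Qed.

Lemma horner_homogenised (F : fieldType) N (n l p : {poly F}) (x z : F) :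
  (size p <= N.+1)%N -> l.[x] * z = n.[x] ->
  (homogenised N n l p).[x] = l.[x] ^+ N * p.[z].
Proof.
move=> sp E; rewrite /homogenised horner_sum (horner_coef_wide z sp) big_distrr /=.
apply: eq_bigr => k _; rewrite hornerZ hornerM !horner_exp -E exprMn.
have kN : (k <= N)%N by rewrite -ltnS.
have -> : l.[x] ^+ N = l.[x] ^+ (N - k) * l.[x] ^+ k by rewrite -exprD subnK.
by ring.
Qed.

Section MoebiusPullback.

Variables (L : closedFieldType) (a b c d : L) (f : {poly L}) (N : nat).
Hypothesis det : a * d - b * c != 0.
Hypothesis sep : separable_poly f.
Hypotheses (evN : ~~ odd N) (sizeN : (size f <= N.+1)%N).

Let n : {poly L} := a%:P * 'X + b%:P.
Let l : {poly L} := c%:P * 'X + d%:P.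

Let horner_linear u w z : (u%:P * 'X + w%:P : {poly L}).[z] = u * z + w.
Proof. by rewrite !horner_simp. Qed.

Let factorE r : n - r *: l = (a - r * c)%:P * 'X + (b - r * d)%:P.
Proof.
rewrite /n /l scalerDr -mul_polyC -[r *: d%:P]mul_polyC !polyCB !polyCM; ring.
Qed.

Let linear_neq0 u w : (u != 0) || (w != 0) -> u%:P * 'X + w%:P != 0 :> {poly L}.
Proof.
move=> uw; rewrite -size_poly_eq0 size_MXaddC polyC_eq0.
by case: eqP uw => //= _ /negbTE->.
Qed.

Let factor_neq0 r : n - r *: l != 0.
Proof.
rewrite factorE linear_neq0 //; apply: contraNT det; rewrite negb_or !negbK !subr_eq0.
by move=> /andP[/eqP-> /eqP->]; apply/eqP; ring.
Qed.

Let l_neq0 : l != 0.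
Proof.
apply: linear_neq0; apply: contraNT det; rewrite negb_or !negbK.
by move=> /andP[/eqP-> /eqP->]; rewrite !mulr0 subrr.
Qed.

Let size_linear u w : (size (u%:P * 'X + w%:P : {poly L})%R <= 2)%N.
Proof.
by rewrite size_MXaddC; case: ifP => // _; rewrite ltnS size_polyC_leq1.
Qed.

Let factored : exists rs, [/\ uniq rs, size rs = (size f).-1,
  forall z, root f z = (z \in rs) &
  homogenised N n l f = lead_coef f *: (\prod_(r <- rs) (n - r *: l) * l ^+ (N - size rs))].
Proof.
have [rs [lc0 urs fE]] := separable_roots sep.
have srs : size f = (size rs).+1 by rewrite fE size_scale // size_prod_XsubC.
exists rs; split=> //.
- by rewrite srs.
- by move=> z; rewrite fE rootZ // root_prod_XsubC.
rewrite {1}fE homogenisedZ -homogenised_prod subnKC //.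
by rewrite -ltnS -srs.
Qed.

Lemma homogenised_neq0 : homogenised N n l f != 0.
Proof.
have [rs [_ _ _ ->]] := factored.
rewrite scaler_eq0 lead_coef_eq0 (negbTE (separable_poly_neq0 sep)) /=.
rewrite mulf_neq0 ?expf_neq0 // prodf_seq_neq0; apply/allP => r _.
by rewrite implyTb factor_neq0.
Qed.

Lemma odd_mup_homogenised z :
  odd (mup z (homogenised N n l f)) =
  if c * z + d == 0 then ~~ odd (size f) else root f ((a * z + b) / (c * z + d)).
Proof.
have f0 := separable_poly_neq0 sep.
have [rs [urs srs rootE ->]] := factored.
rewrite -mul_polyC mupMr ?rootC ?lead_coef_eq0 // mupM; last by rewrite expf_neq0.
  have -> : mup z (l ^+ (N - size rs)) = ((c * z + d == 0)%R * (N - size rs))%N.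
    elim: (N - size rs)%N => [|e IH]; first by rewrite expr0 mupNroot ?root1 ?muln0.
    rewrite exprS mupM ?expf_neq0 // IH (mup_linear _ l_neq0 (size_linear _ _)).
    by rewrite /root /l horner_linear mulnS.
  have -> : mup z (\prod_(r <- rs) (n - r *: l)) =
      count (fun r => a * z + b == r * (c * z + d)) rs.
    elim: rs {urs srs rootE} => [|r rs IH]; first by rewrite big_nil mupNroot ?root1.
    rewrite big_cons mupM ?IH //; last first.
      by rewrite prodf_seq_neq0; apply/allP => r' _; rewrite implyTb factor_neq0.
    rewrite mup_linear ?factor_neq0 // factorE ?size_linear // /root horner_linear /=.
    congr (nat_of_bool _ + _)%N.
    by rewrite -[in RHS]subr_eq0; congr (_ == _); ring.
  case: eqVneq => [E|E].
    rewrite mul1n E; have ab0 : a * z + b != 0.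
      apply: contraNneq det => E'.
      have -> : a * d - b * c = a * (c * z + d) - (a * z + b) * c by ring.
      by rewrite E E' mulr0 mul0r subrr.
    rewrite (@eq_count _ _ pred0) ?count_pred0; last first.
      by move=> r; rewrite mulr0 (negbTE ab0).
    rewrite add0n oddB; last by rewrite srs -subn1 leq_subLR add1n.
    rewrite (negbTE evN) srs; case: (size f) (size_poly_gt0 f) => [|m] /=.
      by rewrite f0.
    by rewrite negbK.
  rewrite mul0n addn0 rootE (@eq_count _ _ (pred1 ((a * z + b) / (c * z + d)))).
    by rewrite count_uniq_mem //; case: (_ \in rs).
  by move=> r /=; rewrite -(inj_eq (mulIf E) r) divfK // eq_sym.
by rewrite prodf_seq_neq0; apply/allP => r _; rewrite implyTb factor_neq0.
Qed.

Lemma size_homogenised_affine : c = 0 -> size (homogenised N n l f) = size f.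
Proof.
move=> c0; have [rs [_ srs _ ->]] := factored.
have f0 := separable_poly_neq0 sep.
have [a0 d0] : a != 0 /\ d != 0.
  by move: det; rewrite c0 mulr0 subr0 mulf_eq0 negb_or => /andP[].
have -> : l = d%:P by rewrite /l c0 mul0r add0r.
rewrite size_scale ?lead_coef_eq0 // -polyC_exp mulrC mul_polyC size_scale ?expf_neq0 //.
have -> : size f = (size rs).+1 by rewrite srs prednK // size_poly_gt0.
elim: rs {srs} => [|r rs IH]; first by rewrite big_nil size_poly1.
have r2 : size (n - r *: d%:P) = 2%N.
  by rewrite /n -addrA -mul_polyC -polyCM -polyCB size_MXaddC polyC_eq0 (negbTE a0) size_polyC a0.
rewrite big_cons size_mul -?size_poly_eq0 ?r2 ?IH //.
Qed.

End MoebiusPullback.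

Lemma odd_size_mul_square (F : fieldType) (p u : {poly F}) : p != 0 -> u != 0 ->
  odd (size (p * u ^+ 2)) = odd (size p).
Proof.
move=> p0 u0; rewrite expr2 !size_mul ?mulf_neq0 //.
rewrite (polySpred p0) (polySpred u0); move: (size p).-1 (size u).-1 => m n.
by rewrite !(addSn, addnS) /= oddD addnn odd_double addbF.
Qed.

Section BranchPoints.

Variables (K F : fieldType) (L : closedFieldType) (i : {rmorphism K -> F}) (j : {rmorphism K -> L}).
Hypothesis two0 : (2%:R : K) != 0.
Variables (f1 f2 : {poly K}) (x1 y1 x2 y2 : F) (a b c d : K).
Hypotheses (F1 : is_function_field i f1 x1 y1) (F2 : is_function_field i f2 x2 y2).
Hypotheses (sep1 : separable_poly f1) (size1 : (5 < size f1)%N).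
Hypotheses (sep2 : separable_poly f2) (size2 : (5 < size f2)%N).
Hypothesis det : a * d - b * c != 0.
Hypothesis x12 : (i c * x1 + i d) * x2 = i a * x1 + i b.

Let N := ((size f2)./2.*2)%N.
Let evN : ~~ odd N. Proof. by rewrite odd_double. Qed.
Let sizeN : (size f2 <= N.+1)%N.
Proof. by rewrite -[X in (X <= _)%N]odd_double_half -add1n leq_add2r leq_b1. Qed.

Let n : {poly K} := a%:P * 'X + b%:P.
Let l : {poly K} := c%:P * 'X + d%:P.

Lemma square_class_pullback : exists u w : {poly K},
  u != 0 /\ homogenised N n l f2 * u ^+ 2 = w ^+ 2 * f1.
Proof.
have [p [q [r [r0 y2E]]]] := function_field_quadratic F1 y2.
have y2S : y2 ^+ 2 = (map_poly i f2).[x2] by case: F2.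
have y1S : y1 ^+ 2 = (map_poly i f1).[x1] by case: F1.
have r21 : rational_in i x2 x1 by exact: (abscissa_rational j two0 F2 F1 sep2 size2).
have r12 : rational_in i x1 x2 by exact: (abscissa_rational j two0 F1 F2 sep1 size1).
have sq : ((map_poly i p).[x1] + (map_poly i q).[x1] * y1) ^+ 2 =
    (map_poly i r).[x1] ^+ 2 * (map_poly i f2).[x2].
  by rewrite -y2S -exprMn y2E [X in _ = X ^+ 2]mulrC divfK.
have ratsq : rational_in i x1 ((map_poly i r).[x1] ^+ 2 * (map_poly i f2).[x2]).
  apply: rational_mul; last exact: rational_horner.
  by rewrite expr2; apply: rational_mul; apply: rational_poly.
case: (square_rational F1 two0 j sep1 size1 ratsq sq) => [p0|q0]; last first.
  case: (y_not_rational F2 j sep2 size2); apply: rational_trans r21 _.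
  by exists p, r; split=> //; rewrite y2E q0 rmorph0 horner0 mul0r addr0.
exists r, (l ^+ (size f2)./2 * q); split.
  by apply: contraNneq r0 => ->; rewrite rmorph0 horner0.
apply: (ev_inj F1); rewrite exprMn -exprM muln2.
have lE : (map_poly i l).[x1] * x2 = (map_poly i n).[x1].
  by rewrite /l /n !rmorphD !rmorphM /= !map_polyC map_polyX !horner_simp.
rewrite rmorphM /= hornerM map_homogenised (horner_homogenised _ lE) ?size_map_poly //.
rewrite !expr2 !rmorphM /= !horner_simp -y1S.
have sq' : (map_poly i r).[x1] * (map_poly i r).[x1] * (map_poly i f2).[x2] =
    (map_poly i q).[x1] ^+ 2 * y1 ^+ 2.
  by rewrite -expr2 -sq p0 rmorph0 horner0 add0r exprMn.
rewrite rmorphXn horner_exp -/N [X in _ * X]mulrC -[X in X = _]mulrA [X in _ * X = _]mulrC.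
by rewrite sq' expr2; ring.
Qed.

Let detj : j a * j d - j b * j c != 0.
Proof. by rewrite -!rmorphM -rmorphB fmorph_eq0. Qed.

Let pullback_L : exists u w : {poly L}, u != 0 /\
  homogenised N ((j a)%:P * 'X + (j b)%:P) ((j c)%:P * 'X + (j d)%:P) (map_poly j f2) * u ^+ 2
  = w ^+ 2 * map_poly j f1.
Proof.
have [u [w [u0 E]]] := square_class_pullback.
exists (map_poly j u), (map_poly j w); rewrite map_poly_eq0; split=> //.
have := congr1 (map_poly j) E; rewrite !expr2 !rmorphM /= map_homogenised.
by rewrite /n /l !rmorphD !rmorphM /= !map_polyC map_polyX.
Qed.

Let sepj2 : separable_poly (map_poly j f2). Proof. by rewrite separable_map. Qed.
Let sepj1 : separable_poly (map_poly j f1). Proof. by rewrite separable_map. Qed.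
Let sizeNj : (size (map_poly j f2) <= N.+1)%N. Proof. by rewrite size_map_poly. Qed.

Lemma branch_moebius_finite z :
  branch j f1 (Some z) = branch j f2 (moebius (j a) (j b) (j c) (j d) (Some z)).
Proof.
have [u [w [u0 E]]] := pullback_L.
have := odd_mup_square_multiple z (homogenised_neq0 detj sepj2 sizeNj)
  (separable_poly_neq0 sepj1) u0 E.
rewrite odd_mup_homogenised // mup_separable_roots // size_map_poly.
by rewrite /branch /=; case: ifP => _ ->; case: (root _ z).
Qed.

Lemma branch_affine_infinity : c = 0 -> odd (size f1) = odd (size f2).
Proof.
move=> c0; have [u [w [u0 E]]] := pullback_L.
have h0 := homogenised_neq0 detj sepj2 sizeNj.
have f10 := separable_poly_neq0 sepj1.
have w0 : w != 0.
  apply: contraTneq h0 => w0; move/eqP: E; rewrite w0 expr0n mul0r mulf_eq0 expf_eq0 /=.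
  by rewrite (negbTE u0) orbF => ->.
rewrite -(size_map_poly j f1) -(size_map_poly j f2).
rewrite -(odd_size_mul_square f10 w0) mulrC -E odd_size_mul_square //.
by rewrite size_homogenised_affine // c0 rmorph0.
Qed.

End BranchPoints.

Lemma branch_moebius (K F : fieldType) (L : closedFieldType) (i : {rmorphism K -> F})
    (j : {rmorphism K -> L}) (f1 f2 : {poly K}) (x1 y1 x2 y2 : F) :
  (2%:R : K) != 0 ->
  is_function_field i f1 x1 y1 -> is_function_field i f2 x2 y2 ->
  separable_poly f1 -> (5 < size f1)%N -> separable_poly f2 -> (5 < size f2)%N ->
  exists a b c d : L, a * d - b * c != 0 /\
    forall P, branch j f1 P = branch j f2 (moebius a b c d P).
Proof.
move=> two0 F1 F2 sep1 size1 sep2 size2.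
have r12 : rational_in i x1 x2 by exact: (abscissa_rational j two0 F1 F2 sep1 size1).
have r21 : rational_in i x2 x1 by exact: (abscissa_rational j two0 F2 F1 sep2 size2).
have [a [b [c [d [det x12]]]]] := exists_moebius_relation j
  (function_field_transcendental F1) (function_field_transcendental F2) r12 r21.
have detj : j a * j d - j b * j c != 0 by rewrite -!rmorphM -rmorphB fmorph_eq0.
exists (j a), (j b), (j c), (j d); split=> // -[z|].
  exact: (branch_moebius_finite j two0 F1 F2 sep1 size1 sep2 size2 det x12).
have [c0|c0] := eqVneq c 0.
  rewrite /= c0 rmorph0 eqxx /=.
  by rewrite (branch_affine_infinity j two0 F1 F2 sep1 size1 sep2 size2 det x12 c0).
have det' : d * a - - b * - c != 0 by rewrite mulrNN mulrC.
have x21 : (i (- c) * x2 + i a) * x1 = i d * x2 + i (- b).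
  move: x12; rewrite !rmorphN mulrDl => x12.
  have -> : (- i c * x2 + i a) * x1 = i a * x1 + i b - i c * x1 * x2 - i b by ring.
  by rewrite -x12; ring.
have := branch_moebius_finite j two0 F2 F1 sep2 size2 sep1 size1 det' x21 (j a / j c).
have MN : moebius (j a) (j b) (j c) (j d) None = Some (j a / j c).
  by rewrite /= fmorph_eq0 (negbTE c0).
by rewrite -MN !rmorphN moebiusK.
Qed.

Lemma is_function_field_transport (K F1 F2 : fieldType) (i1 : {rmorphism K -> F1})
    (i2 : {rmorphism K -> F2}) (phi : {rmorphism F1 -> F2}) (f : {poly K}) (x y : F1) :
  bijective phi -> (forall k, phi (i1 k) = i2 k) ->
  is_function_field i1 f x y -> is_function_field i2 f (phi x) (phi y).
Proof.
move=> [psi phiK psiK] i12 [tr y2 gen].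
have hornerE p : (map_poly i2 p).[phi x] = phi (map_poly i1 p).[x].
  rewrite -horner_map -map_poly_comp; congr (_.[_]); apply: eq_map_poly => k.
  by rewrite /= i12.
split=> [p p0||S SK Sx Sy SB SM SV z].
- by rewrite hornerE fmorph_eq0 tr.
- by rewrite -rmorphXn y2 hornerE.
rewrite -(psiK z); apply: (gen (fun u => phi u \in S)) => //.
- by move=> k; rewrite unfold_in i12.
- by move=> u u'; rewrite !unfold_in rmorphB; apply: SB.
- by move=> u u'; rewrite !unfold_in rmorphM; apply: SM.
- by move=> u; rewrite !unfold_in fmorphV; apply: SV.
Qed.

Lemma hyperelliptic_poly_size (K : fieldType) (f : {poly K}) :
  hyperelliptic_poly f -> (5 < size f)%N.
Proof.
case=> _ [g [g2 sf]]; have g4 : (4 <= 2 * g)%N by rewrite (leq_mul2l 2 2 g) g2.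
by case: sf => ->; rewrite ?addn3 ?addn2 !ltnS // ltnW.
Qed.

Theorem theorem14p4 (K : fieldType) (L : closedFieldType)
  (j : {rmorphism K -> L}) (v : L -> rat)
  (Hloc : local_field_setup j v)
  (f1 f2 : {poly K})
  (H1 : hyperelliptic_poly f1) (H2 : hyperelliptic_poly f2)
  (Hiso : curves_iso_over f1 f2)
  (A1 A2 : cpic)
  (HA1 : cluster_picture_of j v f1 A1) (HA2 : cluster_picture_of j v f2 A2) :
  cp_equiv A1 A2.
Proof.
have [vP _ _ _ [_ [two0 _]]] := Hloc.
have [[sep1 _] [sep2 _]] := (H1, H2).
have [size1 size2] := (hyperelliptic_poly_size H1, hyperelliptic_poly_size H2).
have [F1 [F2 [i1 [i2 [x1 [y1 [x2 [y2 [phi [FF1 FF2 phi_bij i12]]]]]]]]]] := Hiso.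
have FF1' := is_function_field_transport phi_bij i12 FF1.
have [a [b [c [d [det br]]]]] := branch_moebius j two0 FF1' FF2 sep1 size1 sep2 size2.
have [|E1 [w1 [pi1 [t1 m1]]]] := exists_even_model vP sep1 _ HA1.
  exact: ltn_trans size1.
have [|E2 [w2 [pi2 [t2 m2]]]] := exists_even_model vP sep2 _ HA2.
  exact: ltn_trans size2.
exact: even_model_equiv vP det br m1 m2.
Qed.
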